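(* Let $A$ and $B$ be reduced orders and let $G$ and $H$ be finite abelian groups. Then the following are equivalent: (1) $A[G]\cong B[H]$ as rings; (2) there exist an order $C$ and finite abelian groups $I$ and $J$ such that $A\cong C[I]$ and $B\cong C[J]$ as rings and $I\times G\cong J\times H$ as groups.
   Context: All rings have a unit element. An order is a commutative ring whose additive group is isomorphic to $\mathbb{Z}^n$ for some $n\in\mathbb{Z}_{\geq 0}$. A commutative ring is reduced if it has no non-zero nilpotent elements. For a ring $A$ and a group $G$, $A[G]$ denotes the group ring. *)

(* Defs.v *)
From mathcomp Require Import all_boot all_algebra.
Set Implicit Arguments. Unset Strict Implicit. Unset Printing Implicit Defensive.
Import GRing.Theory.
Local Open Scope ring_scope.

Definition is_order (A : comPzRingType) : Prop :=
  exists n : nat, exists f : A -> 'rV[int]_n,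
    bijective f /\ (forall x y : A, f (x + y) = f x + f y).

Definition is_reduced (A : comPzRingType) : Prop :=
  forall (x : A) (n : nat), x ^+ n = 0 -> x = 0.

Definition grp_ring (A : comPzRingType) (G : finZmodType) := {ffun G -> A}.

Definition gr_add (A : comPzRingType) (G : finZmodType)
  (f g : grp_ring A G) : grp_ring A G := [ffun x => f x + g x].

Definition gr_mul (A : comPzRingType) (G : finZmodType)
  (f g : grp_ring A G) : grp_ring A G :=
  [ffun x => \sum_(y : G) f y * g (x - y)].

Definition gr_one (A : comPzRingType) (G : finZmodType) : grp_ring A G :=
  [ffun x => (x == 0)%:R].

Definition is_ring_iso (X Y : Type) (addX mulX : X -> X -> X) (oneX : X)
  (addY mulY : Y -> Y -> Y) (oneY : Y) (f : X -> Y) : Prop :=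
  [/\ bijective f,
      (forall x y, f (addX x y) = addY (f x) (f y)),
      (forall x y, f (mulX x y) = mulY (f x) (f y)) &
      f oneX = oneY].

Definition grp_rings_iso (A B : comPzRingType) (G H : finZmodType) : Prop :=
  exists f : grp_ring A G -> grp_ring B H,
    is_ring_iso (@gr_add A G) (@gr_mul A G) (@gr_one A G)
                (@gr_add B H) (@gr_mul B H) (@gr_one B H) f.

Definition ring_iso_grp_ring (A C : comPzRingType) (I : finZmodType) : Prop :=
  exists f : A -> grp_ring C I,
    is_ring_iso +%R *%R 1 (@gr_add C I) (@gr_mul C I) (@gr_one C I) f.

Definition prod_grp_iso (I G J H : finZmodType) : Prop :=
  exists f : (I * G)%type -> (J * H)%type,
    bijective f /\
    (forall p q : I * G,
        f (p.1 + q.1, p.2 + q.2) = ((f p).1 + (f q).1, (f p).2 + (f q).2)).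

(* Main.v *)
(** For a reduced order R, the form <x,y> = sum over all ring morphisms
    tau : R -> C of tau(x) * conj(tau(y)) is positive definite.  If R = A[G], then
    the lattices A g (g in G) are pairwise orthogonal, because twisting by a
    character of G permutes the tau.  Any two orthogonal projectors that
    preserve the lattice R commute: by integrality of traces, alternating
    projections become stationary.  Hence idempotents of A[G] lie in A, and two
    presentations R = A[G] = B[H] yield, for g in G and h in H, idempotents
    g^-1 (g)_h of R.  If R is connected, then every g lies in some B h, and every h
    in some A g, which defines morphisms phi : G -> H and psi : H -> G.

    Suppose moreover that G is cyclic of prime power order q.  Either
    psi o phi is bijective, and G can be exchanged with a cyclic factor of order q
    of H, so that this factor cancels: A = B[H'] with H = Z/q x H'.  Or
    1 - psi o phi is bijective, and replacing g by g / phi(g) puts G inside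
    B; then B = C[G] with C the intersection of A and B, and A = R / (G - 1) = C[H].
    The second conclusion implies the first when q is among the orders of the
    chosen cyclic factors of H, so the same conclusion can be used on all connected
    components of R and the components reassembled.  The theorem follows by
    induction on the number of cyclic factors of G. *)

From HB Require Import structures.
Require Import Defs.
From mathcomp Require Import all_boot all_order all_algebra all_fingroup all_solvable all_field.
From mathcomp Require Import ring.
From Stdlib Require Import Classical ClassicalEpsilon.
Set Implicit Arguments. Unset Strict Implicit. Unset Printing Implicit Defensive.
Import Order.TTheory GRing.Theory Num.Theory.
Local Open Scope ring_scope.

(** * The group ring as a commutative ring *)

Definition gring (A : comPzRingType) (G : finZmodType) := grp_ring A G.

(** Only the pointwise addition is taken over from [{ffun G -> A}]; the separate name lets
    convolution be the product. *)
HB.instance Definition _ (A : comPzRingType) (G : finZmodType) :=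
  GRing.Zmodule.copy (gring A G) {ffun G -> A}.

Lemma gring_sumE (A : comPzRingType) (G : finZmodType) I (r : seq I) (P : pred I)
    (F : I -> gring A G) x :
  (\sum_(i <- r | P i) F i) x = \sum_(i <- r | P i) F i x.
Proof. by elim/big_rec2: _ => [|i y z _ <-]; rewrite !ffunE. Qed.

Lemma gr_mulC (A : comPzRingType) (G : finZmodType) : commutative (@gr_mul A G).
Proof.
move=> f g; apply/ffunP => x; rewrite !ffunE.
rewrite (reindex_inj (inv_inj (subKr x))) /=.
by apply: eq_bigr => y _; rewrite subKr mulrC.
Qed.

Lemma gr_mulA (A : comPzRingType) (G : finZmodType) : associative (@gr_mul A G).
Proof.
move=> f g h; apply/ffunP => x; rewrite !ffunE.
under eq_bigr do rewrite ffunE mulr_sumr.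
under [RHS]eq_bigr do rewrite ffunE mulr_suml.
rewrite [RHS]exchange_big /=; apply: eq_bigr => y _.
rewrite [RHS](reindex_inj (addIr y)) /=; apply: eq_bigr => z _.
by rewrite addrK mulrA opprD addrA addrAC.
Qed.

Lemma gr_mul1 (A : comPzRingType) (G : finZmodType) :
  left_id (@gr_one A G) (@gr_mul A G).
Proof.
move=> f; apply/ffunP => x; rewrite !ffunE (bigD1 0) //= ffunE eqxx mul1r subr0.
by rewrite big1 ?addr0 // => y /negPf y0; rewrite ffunE y0 mul0r.
Qed.

Lemma gr_mulDl (A : comPzRingType) (G : finZmodType) :
  left_distributive (@gr_mul A G) (+%R : gring A G -> gring A G -> gring A G).
Proof.
move=> f g h; apply/ffunP => x; rewrite !ffunE -big_split /=.
by apply: eq_bigr => y _; rewrite ffunE mulrDl.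
Qed.

HB.instance Definition _ (A : comPzRingType) (G : finZmodType) :=
  GRing.Zmodule_isComPzRing.Build (gring A G)
    (@gr_mulA A G) (@gr_mulC A G) (@gr_mul1 A G) (@gr_mulDl A G).

(** * Ring isomorphisms *)

(** Between types [gring], or from a ring to a [gring], this is convertible to [grp_rings_iso] and
    [ring_iso_grp_ring]. *)
Definition riso (A B : comPzRingType) : Prop :=
  exists f : A -> B, is_ring_iso +%R *%R 1 +%R *%R 1 f.

Lemma rmorph_pack (A B : pzRingType) (f : A -> B) :
  (forall x y, f (x + y) = f x + f y) -> (forall x y, f (x * y) = f x * f y) ->
  f 1 = 1 -> exists g : {rmorphism A -> B}, g = f :> (A -> B).
Proof.
move=> fD fM f1.
have f0 : f 0 = 0 by apply: (addrI (f 0)); rewrite -fD !addr0.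
pose F : {rmorphism A -> B} := HB.pack f (GRing.isNmodMorphism.Build A B f (conj f0 fD))
  (GRing.isMonoidMorphism.Build A B f (conj f1 fM)).
by exists F.
Qed.

Lemma risoP (A B : comPzRingType) :
  riso A B <-> exists f : {rmorphism A -> B}, bijective f.
Proof.
split=> [[f [bf fD fM f1]]|[f bf]].
  by have [g gE] := rmorph_pack fD fM f1; exists g; rewrite gE.
by exists f; split=> //; [exact: rmorphD|exact: rmorphM|exact: rmorph1].
Qed.

Lemma riso_can (A B : comPzRingType) (f : {rmorphism A -> B}) g :
  cancel f g -> cancel g f -> riso A B.
Proof. by move=> fK gK; apply/risoP; exists f; exists g. Qed.

Lemma riso_refl (A : comPzRingType) : riso A A.
Proof. by apply/risoP; exists idfun; exists id. Qed.

Lemma riso_trans (B A C : comPzRingType) : riso A B -> riso B C -> riso A C.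
Proof.
move=> /risoP[f bf] /risoP[g bg]; apply/risoP; exists (g \o f).
exact: bij_comp.
Qed.

Lemma riso_sym (A B : comPzRingType) : riso A B -> riso B A.
Proof.
move=> /risoP[f [g fK gK]].
have [||| h hE] := @rmorph_pack B A g.
- by move=> x y; apply: (can_inj fK); rewrite rmorphD !gK.
- by move=> x y; apply: (can_inj fK); rewrite rmorphM !gK.
- by apply: (can_inj fK); rewrite rmorph1 gK.
by apply: (@riso_can _ _ h f); rewrite hE.
Qed.

(* R is, internally, the group ring of G over A: gi embeds A, gu embeds G, and
   gc r g is the coefficient of gu g in r. *)
Record grs (R A : comPzRingType) (G : finZmodType) := Grs {
  gi : {rmorphism A -> R};
  gu : G -> R;
  gc : R -> G -> A;
  gu0 : gu 0 = 1;
  guD : forall g h, gu (g + h) = gu g * gu h;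
  gcE : forall r, r = \sum_g gi (gc r g) * gu g;
  gcK : forall (x : G -> A) g, gc (\sum_h gi (x h) * gu h) g = x g }.

(** * Coefficients and projectors of an internal group ring *)

Section GrsTheory.
Variables (R A : comPzRingType) (G : finZmodType) (s : grs R A G).

Lemma guN g : gu s g * gu s (- g) = 1.
Proof. by rewrite -guD subrr gu0. Qed.

Lemma guNl g : gu s (- g) * gu s g = 1.
Proof. by rewrite mulrC guN. Qed.

Lemma guMn g n : gu s (g *+ n) = gu s g ^+ n.
Proof. by elim: n => [|n IH]; rewrite ?gu0 // mulrS guD IH exprS. Qed.

Lemma gcMu a h r g : gc s (gi s a * gu s h * r) g = a * gc s r (g - h).
Proof.
rewrite -[RHS](gcK s (fun g => a * gc s r (g - h)) g); congr (gc s _ g).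
rewrite {1}(gcE s r) mulr_sumr [RHS](reindex_inj (addIr h)) /=.
by apply: eq_bigr => k _; rewrite addrK rmorphM guD; ring.
Qed.

Lemma gcM a r g : gc s (gi s a * r) g = a * gc s r g.
Proof. by have := gcMu a 0 r g; rewrite gu0 mulr1 subr0. Qed.

Lemma gcD r t g : gc s (r + t) g = gc s r g + gc s t g.
Proof.
rewrite -[RHS](gcK s (fun g => gc s r g + gc s t g) g); congr (gc s _ g).
rewrite {1}(gcE s r) {1}(gcE s t) -big_split /=.
by apply: eq_bigr => k _; rewrite rmorphD mulrDl.
Qed.

Lemma gc0 g : gc s 0 g = 0.
Proof. by apply: (addrI (gc s 0 g)); rewrite -gcD !addr0. Qed.

Lemma gc_sum I (r : seq I) (P : pred I) (F : I -> R) g :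
  gc s (\sum_(i <- r | P i) F i) g = \sum_(i <- r | P i) gc s (F i) g.
Proof.
by elim/big_rec2: _ => [|i y z _ <-]; rewrite ?gc0 // gcD.
Qed.

Lemma gc_i a g : gc s (gi s a) g = a *+ (g == 0).
Proof.
rewrite -[RHS](gcK s (fun g => a *+ (g == 0)) g); congr (gc s _ g).
rewrite (bigD1 0) //= gu0 eqxx !mulr1 big1 ?addr0 // => h /negPf h0.
by rewrite h0 rmorph0 mul0r.
Qed.

Lemma gc_iu a h g : gc s (gi s a * gu s h) g = a *+ (g == h).
Proof.
have := gcMu a h 1 g; rewrite mulr1 => ->.
by rewrite -(rmorph1 (gi s)) gc_i subr_eq0 mulrnAr mulr1.
Qed.

Lemma gi_inj : injective (gi s).
Proof. by move=> a b /(congr1 (fun r => gc s r 0)); rewrite !gc_i eqxx. Qed.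

(** The A-linear projector of R onto its summand A g. Its values are in R, not in A, so that
    projectors of different presentations can be composed. *)
Definition gproj g r := gi s (gc s r g) * gu s g.

Lemma gprojD g r t : gproj g (r + t) = gproj g r + gproj g t.
Proof. by rewrite /gproj gcD rmorphD mulrDl. Qed.

Lemma gprojp g h r : gproj g (gproj h r) = gproj g r *+ (g == h).
Proof.
rewrite /gproj gc_iu rmorphMn mulrnAl.
by case: eqP => [->|_]; rewrite ?mulr0n.
Qed.

Lemma gprojM g a r : gproj g (gi s a * r) = gi s a * gproj g r.
Proof. by rewrite /gproj gcM rmorphM mulrA. Qed.

Lemma gproj_sum r : \sum_g gproj g r = r.
Proof. by rewrite -gcE. Qed.

Lemma gproj0E r : gproj 0 r = gi s (gc s r 0).
Proof. by rewrite /gproj gu0 mulr1. Qed.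

Lemma gproj0i a : gproj 0 (gi s a) = gi s a.
Proof. by rewrite gproj0E gc_i eqxx. Qed.

Lemma gproj_iu g a : gproj g (gi s a * gu s g) = gi s a * gu s g.
Proof. by rewrite /gproj gc_iu eqxx. Qed.

End GrsTheory.

(** * Morphisms out of a group ring *)

Lemma gev_rmorph (R C : comPzRingType) (H : finZmodType) (i : {rmorphism C -> R})
    (u : H -> R) : u 0 = 1 -> (forall g h, u (g + h) = u g * u h) ->
  exists F : {rmorphism gring C H -> R}, forall x, F x = \sum_h i (x h) * u h.
Proof.
move=> u0 uD.
have [|||F FE] := @rmorph_pack (gring C H) R (fun x => \sum_h i (x h) * u h).
- move=> x y; rewrite -big_split; apply: eq_bigr => h _ /=.
  by rewrite ffunE rmorphD mulrDl.
- move=> x y; rewrite mulr_suml.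
  under eq_bigr do rewrite ffunE rmorph_sum mulr_suml.
  rewrite exchange_big /=; apply: eq_bigr => h _.
  rewrite mulr_sumr (reindex_inj (addIr h)) /=; apply: eq_bigr => k _.
  by rewrite addrK uD rmorphM; ring.
- rewrite (bigD1 0) //= ffunE eqxx u0 rmorph1 mulr1 big1 ?addr0 // => h /negPf h0.
  by rewrite ffunE h0 rmorph0 mul0r.
by exists F => x; rewrite FE.
Qed.

Definition gsingle (A : comPzRingType) (G : finZmodType) (a : A) (g : G) : gring A G :=
  [ffun h => a *+ (h == g)].

Lemma gsingleM (A : comPzRingType) (G : finZmodType) (a b : A) (g h : G) :
  gsingle a g * gsingle b h = gsingle (a * b) (g + h).
Proof.
apply/ffunP => k; rewrite !ffunE (bigD1 g) //= !ffunE eqxx big1 ?addr0; last first.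
  by move=> l /negPf lg; rewrite ffunE lg mul0r.
by rewrite subr_eq addrC mulrnAr.
Qed.

Lemma gsingle_sum (A : comPzRingType) (G : finZmodType) (x : gring A G) :
  x = \sum_g gsingle (x g) g.
Proof.
apply/ffunP => h; rewrite gring_sumE (bigD1 h) //= ffunE eqxx big1 ?addr0 // => g.
by rewrite ffunE eq_sym => /negPf->.
Qed.

(** Lets several group ring structures live on the same ring R, where their projectors and group
    elements can be compared. *)
Lemma grs_riso (R A : comPzRingType) (G : finZmodType) :
  riso (gring A G) R <-> inhabited (grs R A G).
Proof.
split=> [/risoP[f [f' fK f'K]]|[s]].
  have [|||i iE] := @rmorph_pack A R (fun a => f (gsingle a 0)).
  - move=> x y; rewrite -rmorphD; congr (f _).
    by apply/ffunP => g; rewrite !ffunE -mulrnDl.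
  - by move=> x y; rewrite -rmorphM gsingleM addr0.
  - by rewrite -[RHS](rmorph1 f); congr (f _); apply/ffunP => g; rewrite !ffunE.
  pose u (g : G) := f (gsingle 1 g).
  have iuE a g : i a * u g = f (gsingle a g).
    by rewrite iE -rmorphM gsingleM mulr1 add0r.
  have sE (x : G -> A) : \sum_h i (x h) * u h = f [ffun h => x h].
    rewrite [in RHS](gsingle_sum [ffun h => x h]) rmorph_sum.
    by apply: eq_bigr => h _; rewrite iuE ffunE.
  constructor; apply: (@Grs R A G i u (fun r => f' r)).
  - by rewrite -[RHS](rmorph1 f); congr (f _); apply/ffunP => g; rewrite !ffunE.
  - by move=> g h; rewrite -rmorphM gsingleM mulr1.
  - by move=> r; rewrite sE -{1}(f'K r); congr (f _); apply/ffunP => g; rewrite ffunE.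
  - by move=> x g; rewrite sE fK ffunE.
have [F FE] := gev_rmorph (gi s) (gu0 s) (guD s).
apply: (@riso_can _ _ F (fun r => [ffun g => gc s r g])).
  by move=> x; apply/ffunP => g; rewrite ffunE FE gcK.
by move=> r; rewrite FE [RHS](gcE s); apply: eq_bigr => g _; rewrite ffunE.
Qed.

Lemma grs_gring (A : comPzRingType) (G : finZmodType) : inhabited (grs (gring A G) A G).
Proof. by apply/grs_riso; apply: riso_refl. Qed.

(** Universal property of an internal group ring. It yields augmentations when v is constant, and
    twists of complex embeddings when v involves a character. *)
Lemma grs_lift (R A S : comPzRingType) (G : finZmodType) (s : grs R A G)
    (j : {rmorphism A -> S}) (v : G -> S) :
  v 0 = 1 -> (forall x y, v (x + y) = v x * v y) ->
  exists F : {rmorphism R -> S}, forall a g, F (gi s a * gu s g) = j a * v g.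
Proof.
move=> v0 vD.
have [|||F FE] := @rmorph_pack R S (fun r => \sum_g j (gc s r g) * v g).
- by move=> x y; rewrite -big_split; apply: eq_bigr => h _ /=; rewrite gcD rmorphD mulrDl.
- move=> x y; rewrite {1}(gcE s x) mulr_suml.
  under eq_bigr do rewrite gc_sum rmorph_sum mulr_suml.
  rewrite exchange_big mulr_suml; apply: eq_bigr => h _ /=.
  rewrite mulr_sumr (reindex_inj (addIr h)); apply: eq_bigr => k _ /=.
  by rewrite gcMu addrK rmorphM vD; ring.
- rewrite -(rmorph1 (gi s)) (bigD1 0) //= gc_i eqxx v0 mulr1 mulr1n rmorph1.
  rewrite big1 ?addr0 // => g /negPf g0.
  by rewrite gc_i g0 rmorph0 mul0r.
exists F => a g; rewrite FE (bigD1 g) //= gc_iu eqxx big1 ?addr0 // => h /negPf hg.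
by rewrite gc_iu hg rmorph0 mul0r.
Qed.

(* Both A and B are the quotient of R by the ideal generated by the gu s g - 1. *)
Lemma same_group_riso (R A B : comPzRingType) (G : finZmodType)
    (s : grs R A G) (t : grs R B G) : gu s =1 gu t -> riso A B.
Proof.
move=> e.
have aug C (w : grs R C G) : exists F : {rmorphism R -> C},
    (forall c, F (gi w c) = c) /\ (forall g, F (gu w g) = 1).
  have [|F FE] := grs_lift w (idfun : {rmorphism C -> C}) (v := fun=> 1) erefl.
    by move=> x y; rewrite mulr1.
  exists F; split=> [c|g]; first by rewrite -[gi w c]mulr1 -(gu0 w) FE mulr1.
  by rewrite -[gu w g]mul1r -(rmorph1 (gi w)) FE mulr1.
have [F1 [F1i F1u]] := aug A s; have [F2 [F2i F2u]] := aug B t.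
(* Since [F2] also sends every [gu s g] to 1, it does not see the difference between r and its
   augmentation in A. *)
have F12 r : F2 (gi s (F1 r)) = F2 r.
  rewrite (gcE s r) !rmorph_sum; apply: eq_bigr => g _.
  by rewrite !rmorphM F1u !rmorph1 mulr1 F1i e F2u /= mulr1.
have F21 r : F1 (gi t (F2 r)) = F1 r.
  rewrite (gcE t r) !rmorph_sum; apply: eq_bigr => g _.
  by rewrite !rmorphM F2u !rmorph1 mulr1 F2i -e F1u /= mulr1.
apply: (@riso_can _ _ (F2 \o gi s) (F1 \o gi t)) => [a|b] /=.
  by rewrite F21 F1i.
by rewrite F12 F2i.
Qed.

(** * Changing the group or the coefficients of a presentation *)

(** As [v t] and [v (- t)] are inverse to each other, so are [w t] and [w (- t)]. The new basis over
    A is thus the old one, permuted by [th] and rescaled by units. *)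
Lemma change_group (R A : comPzRingType) (G T : finZmodType) (s : grs R A G)
    (v : T -> R) (w : T -> A) (th : T -> G) :
  v 0 = 1 -> (forall x y, v (x + y) = v x * v y) ->
  (forall x y, th (x + y) = th x + th y) -> bijective th ->
  (forall t, v t = gi s (w t) * gu s (th t)) ->
  exists s' : grs R A T, gi s' = gi s /\ gu s' = v.
Proof.
move=> v0 vD thD [th' thK th'K] vE.
have th0 : th 0 = 0 by apply: (addrI (th 0)); rewrite -thD !addr0.
have wN t : w t * w (- t) = 1.
  apply: (gi_inj (s := s)); rewrite rmorph1 rmorphM /=.
  have := v0; rewrite -(subrr t) vD !vE mulrACA -guD -thD subrr th0 gu0 mulr1.
  by [].
have thb : bijective th by exists th'.
have sE x : \sum_h gi s (x h) * v h = \sum_h gi s (x (th' h) * w (th' h)) * gu s h.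
  rewrite [RHS](reindex th) /=; last exact: onW_bij.
  by apply: eq_bigr => h _; rewrite thK vE rmorphM mulrA.
unshelve eexists (@Grs R A T (gi s) v (fun r t => w (- t) * gc s r (th t)) v0 vD _ _); last by [].
  move=> r; rewrite sE [LHS](gcE s); apply: eq_bigr => g _; congr (gi s _ * _).
  by rewrite th'K mulrC mulrA wN mul1r.
by move=> x g; rewrite sE gcK thK mulrCA [w _ * _]mulrC wN mulr1.
Qed.

(** Internal form of B[K x L] = B[L][K]. Only the group elements are recorded in the conclusion,
    since [same_group_riso] compares nothing else. *)
Lemma grs_prod (R B : comPzRingType) (H K L : finZmodType) (s : grs R B H)
    (th : K -> L -> H) (th' : H -> K * L) :
  (forall a b c d, th (a + b) (c + d) = th a c + th b d) ->
  (forall x y, th' (th x y) = (x, y)) -> (forall h, th (th' h).1 (th' h).2 = h) ->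
  exists s' : grs R (gring B L) K, forall a, gu s' a = gu s (th a 0).
Proof.
move=> thD thK th'K.
have th0 : th 0 0 = 0 by apply: (addrI (th 0 0)); rewrite -thD !addr0.
have [||F FE] := @gev_rmorph R B L (gi s) (fun y => gu s (th 0 y)).
- by rewrite /= th0 gu0.
- by move=> g h /=; rewrite -guD -thD addr0.
have thb : bijective (fun p : K * L => th p.1 p.2).
  by exists th' => [[x y]|h] /=; rewrite ?thK ?th'K.
have sE (x : K -> gring B L) : \sum_a F (x a) * gu s (th a 0)
     = \sum_h gi s (x (th' h).1 (th' h).2) * gu s h.
  rewrite [RHS](reindex _ (onW_bij _ thb)) /=.
  rewrite -(pair_bigA _ (fun a b => gi s (x (th' (th a b)).1 (th' (th a b)).2) * gu s (th a b))) /=.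
  apply: eq_bigr => a _; rewrite FE mulr_suml; apply: eq_bigr => b _.
  by rewrite -mulrA -guD -thD addr0 add0r thK.
unshelve eexists (@Grs R (gring B L) K F (fun a => gu s (th a 0))
  (fun r a => [ffun y => gc s r (th a y)]) _ _ _ _); last by [].
- by rewrite /= th0 gu0.
- by move=> g h; rewrite -guD -thD addr0.
- by move=> r; rewrite sE [LHS](gcE s); apply: eq_bigr => h _; rewrite ffunE th'K.
- by move=> x a; apply/ffunP => y; rewrite ffunE sE gcK thK.
Qed.

(** Internal form of C[K][H] = C[H][K]: the inner group is moved outside. *)
Lemma grs_comp (R B C : comPzRingType) (H K : finZmodType) (s : grs R B H)
    (t : grs B C K) :
  exists s' : grs R (gring C H) K, forall a, gu s' a = gi s (gu t a).
Proof.
have [F FE] := gev_rmorph (gi s \o gi t) (gu0 s) (guD s).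
have sE (x : K -> gring C H) : \sum_a F (x a) * gi s (gu t a)
    = \sum_h gi s (\sum_a gi t (x a h) * gu t a) * gu s h.
  under eq_bigr do rewrite FE mulr_suml.
  rewrite exchange_big; apply: eq_bigr => h _; rewrite rmorph_sum mulr_suml.
  by apply: eq_bigr => a _; rewrite rmorphM /=; ring.
unshelve eexists (@Grs R (gring C H) K F (fun a => gi s (gu t a))
  (fun r a => [ffun y => gc t (gc s r y) a]) _ _ _ _); last by [].
- by rewrite /= gu0 rmorph1.
- by move=> g h /=; rewrite guD rmorphM.
- move=> r; rewrite sE [LHS](gcE s); apply: eq_bigr => h _; congr (gi s _ * _).
  by rewrite [LHS](gcE t); apply: eq_bigr => a _; rewrite ffunE.
- by move=> x a; apply/ffunP => y; rewrite ffunE sE !gcK.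
Qed.

(** * Integral orthogonal projectors *)

Definition ctr m n (A : 'M[algC]_(m, n)) : 'M[algC]_(n, m) := map_mx Num.conj A^T.

Lemma ctrK m n (A : 'M[algC]_(m, n)) : ctr (ctr A) = A.
Proof. by apply/matrixP => i j; rewrite !mxE conjCK. Qed.

Lemma ctrM m n p (A : 'M[algC]_(m, n)) (B : 'M[algC]_(n, p)) :
  ctr (A *m B) = ctr B *m ctr A.
Proof. by rewrite /ctr trmx_mul map_mxM. Qed.

Lemma ctrB m n (A B : 'M[algC]_(m, n)) : ctr (A - B) = ctr A - ctr B.
Proof. by apply/matrixP => i j; rewrite !mxE rmorphB. Qed.

Lemma ctr0 m n : ctr (0 : 'M_(m, n)) = 0.
Proof. by apply/matrixP => i j; rewrite !mxE conjC0. Qed.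

(** The squared Frobenius norm, as a trace so that integrality of traces bears on it. *)
Definition sqnorm m n (A : 'M[algC]_(m, n)) : algC := \tr (A *m ctr A).

Lemma sqnormE m n (A : 'M[algC]_(m, n)) : sqnorm A = \sum_i \sum_j `|A i j| ^+ 2.
Proof.
rewrite /sqnorm /mxtrace; apply: eq_bigr => i _; rewrite mxE.
by apply: eq_bigr => j _; rewrite !mxE normCK.
Qed.

Lemma sqnorm_ge0 m n (A : 'M[algC]_(m, n)) : 0 <= sqnorm A.
Proof. by rewrite sqnormE; do 2!apply: sumr_ge0 => ? _; rewrite exprn_ge0. Qed.

Lemma sqnorm_eq0 m n (A : 'M[algC]_(m, n)) : sqnorm A = 0 -> A = 0.
Proof.
rewrite sqnormE => /eqP; rewrite psumr_eq0; last first.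
  by move=> i _; apply: sumr_ge0 => j _; rewrite exprn_ge0.
move=> /allP A0; apply/matrixP => i j; rewrite mxE.
have /= := A0 i (mem_index_enum _); rewrite psumr_eq0; last by move=> ? _; rewrite exprn_ge0.
move=> /allP/(_ j (mem_index_enum _)) /=.
by rewrite expf_eq0 normr_eq0 => /eqP.
Qed.

(** Pythagoras for the orthogonal projector r. *)
Lemma sqnorm_split n m (r : 'M[algC]_n) (X : 'M[algC]_(n, m)) :
  ctr r = r -> r *m r = r -> sqnorm X = sqnorm (r *m X) + sqnorm (X - r *m X).
Proof.
move=> rH rr; rewrite /sqnorm ctrB ctrM rH mulmxBr !mulmxBl !raddfB /=.
rewrite [\tr (X *m (ctr X *m r))]mxtrace_mulC -!mulmxA.
rewrite [\tr (r *m (X *m (ctr X *m r)))]mxtrace_mulC -!mulmxA rr.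
rewrite [\tr (X *m (ctr X *m r))]mxtrace_mulC -!mulmxA.
by rewrite [\tr (ctr X *m _)]mxtrace_mulC -!mulmxA; ring.
Qed.

(** Induction on the first term: either the sequence stalls at once, or its tail starts lower. *)
Lemma nat_seq_stab (a : nat -> algC) : (forall k, a k \is a Num.nat) ->
  (forall k, a k.+1 <= a k) -> exists k, a k.+1 = a k.
Proof.
move=> aN aS; have [b bE] : exists b, forall k, a k = (b k)%:R.
  by exists (fun k => Num.truncn (a k)) => k; rewrite truncnK.
have {aS}bS k : (b k.+1 <= b k)%N by rewrite -(ler_nat algC) -!bE.
suff [k bk]: exists k, b k.+1 = b k by exists k; rewrite !bE bk.
have [m le_m] := ubnP (b 0); elim: m b bS le_m {bE} => // m IH b bS le_m.
have [e|ne] := eqVneq (b 1%N) (b 0%N); first by exists 0%N.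
have [||k e] := IH (fun k => b k.+1); first by move=> k; apply: bS.
  by rewrite (leq_trans _ (le_m : (b 0 <= m)%N)) // ltn_neqAle ne bS.
by exists k.+1.
Qed.

(* The numbers sqnorm ((pqp)^k) are traces, hence a nonincreasing sequence of
   natural numbers; where it stalls, (pqp)^(k+1) = (pqp)^k, which forces pqp to be
   idempotent and then p and q to commute. *)
Lemma commute_projectors n (p q : 'M[algC]_n.+1) :
  ctr p = p -> p *m p = p -> ctr q = q -> q *m q = q ->
  (forall k, \tr ((p * q * p) ^+ k) \is a Num.int) -> p *m q = q *m p.
Proof.
move=> pH pp qH qq trI; set N := p * q * p in trI *.
have NH : ctr N = N by rewrite /N -!mulmxE !ctrM pH qH mulmxA.
have NXH k : ctr (N ^+ k) = N ^+ k.
  elim: k => [|k IH]; last by rewrite {1}exprSr -mulmxE ctrM IH NH mulmxE -exprS.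
  by apply/matrixP => i j; rewrite !mxE eq_sym conjC_nat.
have FE k : sqnorm (N ^+ k) = \tr (N ^+ (k + k)) by rewrite /sqnorm NXH mulmxE -exprD.
have dec (r X : 'M_n.+1) : ctr r = r -> r *m r = r -> sqnorm (r *m X) <= sqnorm X.
  by move=> rH rr; rewrite (sqnorm_split X rH rr) lerDl sqnorm_ge0.
have NS k : N ^+ k.+1 = p *m (q *m (p *m N ^+ k)).
  by rewrite exprS !mulmxA !mulmxE.
have [k Nk] : exists k, sqnorm (N ^+ k.+1) = sqnorm (N ^+ k).
  apply: (nat_seq_stab (a := fun k => sqnorm (N ^+ k))) => k.
    by rewrite natrEint {1}FE trI sqnorm_ge0.
  rewrite NS; apply: le_trans (dec p (q *m (p *m N ^+ k)) pH pp) _.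
  exact: le_trans (dec q _ qH qq) (dec p _ pH pp).
(* The equality case of Pythagoras. *)
have fixr (r X : 'M_n.+1) : ctr r = r -> r *m r = r -> sqnorm X <= sqnorm (r *m X) -> r *m X = X.
  move=> rH rr; rewrite {1}(sqnorm_split X rH rr) gerDl => le0.
  apply/esym/eqP; rewrite -subr_eq0; apply/eqP/sqnorm_eq0/eqP.
  by rewrite eq_le le0 sqnorm_ge0.
have stab : N ^+ k.+1 = N ^+ k.
  move: (Nk); rewrite NS => Nk'.
  have e1 : p *m N ^+ k = N ^+ k.
    by apply: fixr => //; rewrite -Nk'; apply: le_trans (dec p _ pH pp) (dec q _ qH qq).
  rewrite e1 in Nk' *; have e2 : q *m N ^+ k = N ^+ k.
    by apply: fixr => //; rewrite -Nk'; apply: dec.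
  by rewrite e2 e1.
have NN : N ^+ 2 = N.
  elim: k {Nk} stab => [|k IH].
    by rewrite expr1 expr0 => ->; rewrite expr1n.
  (* If the powers are constant from exponent k + 2 on, the Hermitian matrix N^(k+2) - N^(k+1) has
     square zero, hence vanishes, and stationarity descends by one. *)
  case: k IH => [|k] IH // stab; apply: IH.
  have st j : N ^+ (k.+2 + j) = N ^+ k.+2.
    by elim: j => [|j IHj]; rewrite ?addn0 // addnS exprS IHj -exprS.
  apply/eqP; rewrite -subr_eq0; apply/eqP/sqnorm_eq0.
  rewrite /sqnorm ctrB !NXH mulmxE.
  have -> : (N ^+ k.+2 - N ^+ k.+1) * (N ^+ k.+2 - N ^+ k.+1)
     = N ^+ (k.+2 + k.+2) - N ^+ (k.+2 + k.+1) *+ 2 + N ^+ (k.+2 + k).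
    rewrite mulrBl !mulrBr -!exprD mulr2n.
    rewrite (_ : k.+1 + k.+2 = k.+2 + k.+1)%N; last by rewrite addnC.
    by rewrite (_ : k.+1 + k.+1 = k.+2 + k)%N ?addSnnS // !opprD !opprK !addrA.
  by rewrite !st mulr2n opprD addrA subrr sub0r addNr raddf0.
(* Since N is idempotent, the four terms of (pq - N)(qp - N) all equal N up to sign and cancel; so
   pq = N, which is Hermitian. *)
have pqp : p *m q = N.
  apply/eqP; rewrite -subr_eq0; apply/eqP.
  rewrite -[LHS]ctrK; set X := ctr (p *m q - N); suff -> : X = 0 by rewrite ctr0.
  have XE : X = q *m p - N by rewrite /X ctrB ctrM pH qH NH.
  apply: (can_inj (@ctrK _ _)); rewrite ctr0.
  apply: sqnorm_eq0; rewrite /sqnorm ctrK (_ : ctr X *m X = 0) ?raddf0 //.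
  rewrite XE ctrB ctrM pH qH NH mulmxBl !mulmxBr.
  have -> : p *m q *m (q *m p) = N by rewrite !mulmxA -[p *m q *m q]mulmxA qq.
  have e3 : p *m N = N by rewrite /N -!mulmxE !mulmxA pp.
  have e4 : N *m p = N by rewrite /N -!mulmxE -!mulmxA pp.
  have e5 : N *m N = N by rewrite mulmxE -expr2 NN.
  have -> : p *m q *m N = N.
    by rewrite -{1}e3 -{2}e5 /N -!mulmxE !mulmxA.
  have -> : N *m (q *m p) = N.
    by rewrite -{1}e4 -{2}e5 /N -!mulmxE !mulmxA.
  by rewrite e5 !subrr.
rewrite pqp; apply: (can_inj (@ctrK _ _)); by rewrite NH ctrM pH qH pqp.
Qed.

(** * The complex embeddings of a reduced order *)

Lemma morph_add0 (U V : zmodType) (h : U -> V) :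
  {morph h : x y / x + y} -> h 0 = 0.
Proof. by move=> hD; apply: (addrI (h 0)); rewrite -hD !addr0. Qed.

Lemma morph_add_sum (U V : zmodType) (h : U -> V) I (r : seq I) (P : pred I) F :
  {morph h : x y / x + y} ->
  h (\sum_(i <- r | P i) F i) = \sum_(i <- r | P i) h (F i).
Proof. by move=> hD; apply: (big_morph h hD); apply: morph_add0. Qed.

Lemma morph_addMz (U V : zmodType) (h : U -> V) x (k : int) :
  {morph h : x y / x + y} -> h (x *~ k) = h x *~ k.
Proof.
move=> hD; have hn m : h (x *+ m) = h x *+ m.
  by elim: m => [|m IH]; rewrite ?mulr0n ?(morph_add0 hD) // !mulrS hD IH.
case: k => m; first exact: hn.
by apply: (addrI (h x *+ m.+1)); rewrite NegzE !mulrNz subrr -hn -hD subrr (morph_add0 hD).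
Qed.

Lemma scaler_mulz m n (k : int) (v : 'M[int]_(m, n)) : k *: v = v *~ k.
Proof. by rewrite -{1}[k]intz scaler_int. Qed.

Lemma additive_mx n m (h : 'rV[int]_n -> 'rV[int]_m) v :
  {morph h : x y / x + y} -> h v = v *m \matrix_i h (delta_mx 0 i).
Proof.
move=> hD; rewrite {1}(row_sum_delta v) morph_add_sum // mulmx_sum_row.
by apply: eq_bigr => i _; rewrite !scaler_mulz morph_addMz // rowK.
Qed.

Lemma deriv_neq0 (p : {poly rat}) : (1 < size p)%N -> p^`() != 0.
Proof.
case e : (size p) => [|[|k]] // _; apply/eqP => /polyP/(_ k).
rewrite coef_deriv coef0 => /eqP; rewrite mulrn_eq0 /=.
have -> : p`_k.+1 = lead_coef p by rewrite lead_coefE e.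
by rewrite lead_coef_eq0 -size_poly_eq0 e.
Qed.

Section Lattice.
Variables (R : comPzRingType) (n : nat).
Variables (f : R -> 'rV[int]_n.+1) (f' : 'rV[int]_n.+1 -> R).
Hypotheses (fD : {morph f : x y / x + y}) (fK : cancel f f') (f'K : cancel f' f).

Lemma coordVD : {morph f' : x y / x + y}.
Proof. by move=> x y; apply: (can_inj fK); rewrite fD !f'K. Qed.

Definition endo_mx (P : R -> R) : 'M[int]_n.+1 := \matrix_i f (P (f' (delta_mx 0 i))).

Lemma endo_mxE P x : {morph P : x y / x + y} -> f (P x) = f x *m endo_mx P.
Proof.
move=> PD; rewrite -{1}(fK x) (additive_mx (h := fun v => f (P (f' v)))) //.
by move=> v w; rewrite coordVD PD fD.
Qed.

Lemma endo_mx_ext P M : (forall x, f (P x) = f x *m M) -> endo_mx P = M.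
Proof.
by move=> PM; apply/row_matrixP => i; rewrite rowK PM f'K -rowE.
Qed.

(** The regular representation of R on its lattice. *)
Lemma mulmx_exists : exists M : {rmorphism R -> 'M[int]_n.+1},
  forall x y, f (y * x) = f y *m M x.
Proof.
pose M x := endo_mx (fun y => y * x).
have ME x y : f (y * x) = f y *m M x.
  by apply: (endo_mxE (P := fun y => y * x)) => a b; rewrite mulrDl.
have [|||M' M'E] := @rmorph_pack R 'M[int]_n.+1 M.
- by move=> x y; apply: endo_mx_ext => z; rewrite mulrDr fD !ME mulmxDr.
- by move=> x y; apply: endo_mx_ext => z; rewrite mulrA !ME -mulmxE mulmxA.
- by apply: endo_mx_ext => z; rewrite mulr1 mulmx1.
by exists M' => x y; rewrite M'E ME.
Qed.

Hypothesis Rred : is_reduced R.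

(** Makes reducedness of R applicable to polynomials in the matrix of x. *)
Lemma horner_mulmx (M : {rmorphism R -> 'M[int]_n.+1}) x (p : {poly int}) :
  exists y, horner_mx (M x) p = M y.
Proof.
elim/poly_ind: p => [|p c [y IH]]; first by exists 0; rewrite !rmorph0.
exists (y * x + 1 *~ c); rewrite rmorphD rmorphM /= IH horner_mx_X horner_mx_C.
rewrite rmorphD rmorphM rmorphMz rmorph1; congr (_ + _).
by rewrite -[c in LHS]intz -scalemx1 scaler_mulz intz.
Qed.

(** After clearing denominators, reducedness of R shows that a rational polynomial whose square
    annihilates the matrix annihilates it too. The minimal polynomial is therefore squarefree, so
    separable in characteristic 0, and has simple roots in [algC]. *)
Lemma mulmx_diagonalizable (M : {rmorphism R -> 'M[int]_n.+1}) x :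
  (forall x y, f (y * x) = f y *m M x) ->
  diagonalizable (map_mx intr (M x) : 'M[algC]_n.+1).
Proof.
move=> ME; set A : 'M[rat]_n.+1 := map_mx intr (M x).
have M_inj : injective M.
  by move=> y z e; apply: (can_inj fK); rewrite -[y]mul1r -[z]mul1r !ME e.
have hornE (p : {poly rat}) : exists y (c : rat), c != 0 /\
    horner_mx A p = c *: map_mx intr (M y).
  have [q [a a0 ->]] := rat_poly_scale p.
  have [y yE] := horner_mulmx M x q; exists y, (a%:~R^-1).
  rewrite invr_eq0 intr_eq0 a0; split=> //.
  by rewrite linearZ /= -yE map_horner_mx.
have horn_sq (p : {poly rat}) : horner_mx A (p * p) = 0 -> horner_mx A p = 0.
  have [y [c [c0 pE]]] := hornE p; rewrite rmorphM /= pE.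
  rewrite -scalerAl -scalerAr !scalerA => /eqP; rewrite scaler_eq0 mulf_eq0 (negPf c0) /=.
  rewrite -rmorphM /= => /eqP yy0.
  have yy : y * y = 0.
    apply: M_inj; rewrite rmorph0 rmorphM; apply/matrixP => i j; apply: (@intr_inj rat).
    by move/matrixP/(_ i j): yy0; rewrite !mxE => ->.
  by rewrite (Rred (n := 2) (x := y)) ?expr2 // rmorph0 map_mx0 scaler0.
set m := mxminpoly A.
have m0 : m != 0 by rewrite monic_neq0 // mxminpoly_monic.
have sep_m : separable_poly m.
  apply/separable_polyP; split=> [u v uv|u _]; last exact: deriv_neq0.
  (* Here d^2 divides the minimal polynomial m = k d^2, so (k d)^2 = k m annihilates A, hence so
     does k d; by minimality d is constant. *)
  pose d := gcdp u v.
  have /dvdpP[k mE] : d * d %| m.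
    by apply: dvdp_trans uv; rewrite dvdp_mul ?dvdp_gcdl ?dvdp_gcdr.
  have kd0 : horner_mx A (k * d) = 0.
    apply: horn_sq; have -> : k * d * (k * d) = k * m by rewrite mE mulrACA -mulrA.
    by rewrite rmorphM /= mx_root_minpoly mulr0.
  have /dvdp_leq le_m := mxminpoly_min kd0.
  have [nzk nzd] : k != 0 /\ d != 0.
    by apply/andP; move: m0; rewrite mE !mulf_eq0 !negb_or; case/and3P=> -> ->.
  rewrite /coprimep -/d eqn_leq size_poly_gt0 nzd andbT leqNgt; apply/negP => d1.
  have := le_m (mulf_neq0 nzk nzd); rewrite -/m mE mulrA.
  rewrite (size_mul (mulf_neq0 nzk nzd) nzd) leqNgt => /negP; apply.
  rewrite -(ltn_predK d1) addnS /= -ltnS.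
  by move: d1; case: (size d) => [|[|j]] // _ /=; rewrite addnS ltnS leq_addr.
have [r rE] := closed_field_poly_normal (map_poly (ratr : rat -> algC) m).
have mM : map_poly (ratr : rat -> algC) m \is monic.
  by rewrite map_monic mxminpoly_monic.
rewrite (monicP mM) scale1r in rE.
apply/diagonalizableP; exists r.
  by rewrite -separable_prod_XsubC -rE separable_map.
have -> : map_mx intr (M x) = map_mx (ratr : rat -> algC) A :> 'M[algC]_n.+1.
  by apply/matrixP => i j; rewrite !mxE ratr_int.
by rewrite mxminpoly_map rE.
Qed.

(* The multiplication operators of a reduced order commute, and their minimal
   polynomials over the rationals are separable, so they are simultaneously
   diagonalizable over algC; the tau i are the diagonal entries. *)
Lemma embeddings : exists tau : 'I_n.+1 -> {rmorphism R -> algC},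
  (\matrix_(k, i) tau i (f' (delta_mx 0 k)) \in unitmx) /\
  forall s : {rmorphism R -> algC}, exists i, s =1 tau i.
Proof.
have [M ME] := mulmx_exists.
pose MC x : 'M[algC]_n.+1 := map_mx intr (M x).
have MCM x y : MC (x * y) = MC x *m MC y by rewrite /MC rmorphM -mulmxE map_mxM.
have MCD x y : MC (x + y) = MC x + MC y by rewrite /MC rmorphD map_mxD.
have MC1 : MC 1 = 1%:M by rewrite /MC rmorph1 map_mx1.
have MCs x : MC x = \sum_k (f x 0 k)%:~R *: MC (f' (delta_mx 0 k)).
  rewrite -{1}(fK x) {1}(row_sum_delta (f x)) (morph_add_sum _ _ _ coordVD).
  rewrite (morph_add_sum _ _ _ MCD); apply: eq_bigr => k _.
  by rewrite scaler_mulz (morph_addMz _ _ coordVD) (morph_addMz _ _ MCD) scaler_int.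
have [] := codiagonalizableP [seq MC x | x <- [seq f' (delta_mx 0 k) | k <- enum 'I_n.+1]].
case=> [|V Vu /allP VD].
  split; first by move=> _ _ /mapP[x _ ->] /mapP[y _ ->]; rewrite /comm_mx -!MCM mulrC.
  by move=> _ /mapP[x _ ->]; apply: mulmx_diagonalizable.
move=> _; pose D x := V *m MC x *m invmx V.
have Ddiag x i j : i != j -> D x i j = 0.
  move=> ij; rewrite /D MCs mulmx_sumr mulmx_suml summxE big1 // => k _.
  rewrite -scalemxAr -scalemxAl mxE.
  have /VD : MC (f' (delta_mx 0 k)) \in [seq MC x | x <- [seq f' (delta_mx 0 k) | k <- enum 'I_n.+1]].
    by do 2!apply: map_f; rewrite mem_enum.
  by rewrite /= /similar_to /= conjumx // => /is_diag_mxP->; rewrite ?mulr0.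
have DM x y : D (x * y) = D x *m D y by rewrite /D MCM !mulmxA mulmxKV.
have DE x : V *m MC x = D x *m V by rewrite /D mulmxKV.
have tauE i : exists t : {rmorphism R -> algC}, forall x, t x = D x i i.
  have [|||t tE] := @rmorph_pack R algC (fun x => D x i i).
  - by move=> x y; rewrite /D MCD mulmxDr mulmxDl mxE.
  - move=> x y; rewrite DM mxE (bigD1 i) //= big1 ?addr0 // => j ji.
    by rewrite Ddiag ?mul0r // eq_sym.
  - by rewrite /D MC1 mulmx1 mulmxV // mxE eqxx.
  by exists t => x; rewrite tE.
have [tau tauP] : exists tau : 'I_n.+1 -> {rmorphism R -> algC}, forall i x, tau i x = D x i i.
  apply: (fin_all_exists (P := fun i (t : {rmorphism R -> algC}) => forall x, t x = D x i i)).
  exact: tauE.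
exists tau; split.
  (* A relation v between the rows is a relation between the multiplication matrices of the basis
     elements; applied to the coordinates of 1, it reads v = 0. *)
  rewrite -row_free_unit; apply: inj_row_free => v vT.
  have Dv0 : \sum_k v 0 k *: D (f' (delta_mx 0 k)) = 0.
    apply/matrixP => i j; rewrite summxE !mxE; have [<-|ij] := eqVneq i j.
      have := congr1 (fun w : 'rV_n.+1 => w 0 i) vT.
      rewrite [LHS]mxE [RHS]mxE => e; rewrite -[RHS]e.
      by apply: eq_bigr => k _; rewrite mxE [X in _ = _ * X]mxE tauP.
    by apply: big1 => k _; rewrite mxE Ddiag ?mulr0.
  have Mv0 : \sum_k v 0 k *: MC (f' (delta_mx 0 k)) = 0.
    apply: (can_inj (mulKmx Vu)); rewrite mulmx0 mulmx_sumr.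
    under eq_bigr do rewrite -scalemxAr DE scalemxAl.
    by rewrite -mulmx_suml Dv0 mul0mx.
  have oneE y : map_mx intr (f 1) *m MC y = map_mx intr (f y).
    by rewrite -map_mxM -ME mul1r.
  have := congr1 (mulmx (map_mx intr (f 1))) Mv0; rewrite mulmx0 mulmx_sumr => <-.
  rewrite {1}(row_sum_delta v); apply: eq_bigr => k _.
  rewrite -scalemxAr oneE f'K; congr (_ *: _).
  by apply/rowP => j; rewrite !mxE rmorph_nat.
(* The values of s on the basis form a common eigenvector w with eigenvalues [s x]. Any nonzero
   coordinate i of w in the diagonalizing basis gives s = [tau i]. *)
move=> s; have sE y : s y = \sum_k (f y 0 k)%:~R * s (f' (delta_mx 0 k)).
  rewrite -{1}(fK y) {1}(row_sum_delta (f y)) (morph_add_sum _ _ _ coordVD) rmorph_sum.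
  apply: eq_bigr => k _; rewrite scaler_mulz (morph_addMz _ _ coordVD).
  by rewrite -mulrzl rmorphM /= rmorph_int.
pose w : 'cV_n.+1 := \col_k s (f' (delta_mx 0 k)).
have Mw x : MC x *m w = s x *: w.
  apply/colP => k; rewrite !mxE -rmorphM [s _]sE; apply: eq_bigr => l _.
  by rewrite [x * _]mulrC ME f'K -rowE [w l 0]mxE [(row _ _) 0 l]mxE [MC x k l]mxE.
have Vw0 : V *m w != 0.
  apply/eqP => /(congr1 (mulmx (invmx V))); rewrite mulKmx // mulmx0 => w0.
  have := rmorph1 s; rewrite sE big1 => [/esym/eqP|k _]; first by rewrite oner_eq0.
  by have := congr1 (fun u : 'cV_n.+1 => u k 0) w0; rewrite mxE => ->; rewrite mxE mulr0.
have [i Vwi] : exists i, (V *m w) i 0 != 0.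
  by have /matrix0Pn[i [j]] := Vw0; rewrite ord1; exists i.
exists i => x; rewrite tauP; apply: (mulIf Vwi).
have := congr1 (mulmx V) (Mw x); rewrite mulmxA DE -mulmxA -scalemxAr.
move=> /(congr1 (fun u : 'cV_n.+1 => u i 0)); rewrite !mxE => <-.
rewrite (bigD1 i) //= big1 ?addr0 ?mxE // => j ji.
by rewrite Ddiag ?mul0r // eq_sym.
Qed.
End Lattice.

(** * The Hermitian form *)

(** Established below for products of cyclic groups of prime power order, to which all groups are
    eventually reduced. *)
Definition separating (G : finZmodType) := forall g : G, g != 0 ->
  exists chi : G -> algC, [/\ chi 0 = 1, forall x y, chi (x + y) = chi x * chi y,
    forall x, chi x * (chi x)^* = 1 & chi g != 1].

Section InnerProduct.
Variables (R : comPzRingType) (n : nat).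
Variables (f : R -> 'rV[int]_n.+1) (f' : 'rV[int]_n.+1 -> R).
Hypotheses (fD : {morph f : x y / x + y}) (fK : cancel f f') (f'K : cancel f' f).
Variable tau : 'I_n.+1 -> {rmorphism R -> algC}.
Let T := \matrix_(k, i) tau i (f' (delta_mx 0 k)).
Hypotheses (Tu : T \in unitmx)
  (tau_all : forall s : {rmorphism R -> algC}, exists i, s =1 tau i).

Definition ip x y := \sum_i tau i x * (tau i y)^*.

Definition orthoproj (P : R -> R) := [/\ {morph P : x y / x + y},
  forall x, P (P x) = P x & forall x y, ip (P x) y = ip x (P y)].

Let row_tau x := map_mx intr (f x) *m T.

Lemma row_tauE x i : row_tau x 0 i = tau i x.
Proof.
rewrite mxE -{2}(fK x) {2}(row_sum_delta (f x)) (morph_add_sum _ _ _ (coordVD fD fK f'K)).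
rewrite rmorph_sum; apply: eq_bigr => k _; rewrite !mxE scaler_mulz.
by rewrite (morph_addMz _ _ (coordVD fD fK f'K)) rmorphMz /= mulrzl.
Qed.

Lemma ipE x y : (row_tau x *m ctr (row_tau y)) 0 0 = ip x y.
Proof.
rewrite mxE; apply: eq_bigr => i _; rewrite row_tauE.
by rewrite [ctr _ _ _]mxE [_^T _ _]mxE row_tauE.
Qed.

(** In the coordinates [tau i], P and Q are Hermitian idempotent matrices; in a lattice basis they
    are integral. The two kinds of matrices are conjugate by [T], so traces of words in P and Q are
    integers. *)
Lemma orthoproj_comm P Q x : orthoproj P -> orthoproj Q -> P (Q x) = Q (P x).
Proof.
pose E (P : R -> R) : 'M[algC]_n.+1 := map_mx intr (endo_mx f f' P).
pose p (P : R -> R) := invmx T *m E P *m T.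
have EP P' : orthoproj P' -> [/\ ctr (p P') = p P', p P' *m p P' = p P' &
    forall x, f (P' x) = f x *m endo_mx f f' P'].
  move=> [PD PP Psa].
  have PE y : f (P' y) = f y *m endo_mx f f' P' by apply: endo_mxE.
  split=> //; last first.
    rewrite /p !mulmxA mulmxK // -[invmx T *m E P' *m E P']mulmxA; congr (_ *m _ *m _).
    rewrite /E -map_mxM; congr map_mx; apply/esym/(endo_mx_ext f'K) => y.
    by rewrite mulmxA -!PE PP.
  have rtP y : row_tau (P' y) = row_tau y *m p P'.
    by rewrite /row_tau PE map_mxM /p !mulmxA mulmxK.
  (* Self-adjointness, tested on the lattice basis; the units [T] and [ctr T] then cancel. *)
  have {rtP} : T *m p P' *m ctr T = T *m ctr (p P') *m ctr T.
    move: (p P') rtP => X rtP.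
    have rT k : row k T = row_tau (f' (delta_mx 0 k)).
      rewrite /row_tau f'K rowE; congr (_ *m _).
      by apply/rowP => j; rewrite !mxE rmorph_nat.
    apply/matrixP => k l; have := Psa (f' (delta_mx 0 k)) (f' (delta_mx 0 l)).
    rewrite -!ipE !rtP -!rT ctrM !mulmxA.
    have rl (Y : 'M[algC]_n.+1) : (row k T *m Y *m ctr (row l T)) 0 0 = (T *m Y *m ctr T) k l.
      rewrite -row_mul ![in LHS]mxE [RHS]mxE; apply: eq_bigr => j _.
      rewrite [row _ _ _ _]mxE [ctr _ _ _ in LHS]mxE [ctr _ _ _ in RHS]mxE.
      by rewrite [_^T _ _ in LHS]mxE [_^T _ _ in RHS]mxE [row l _ _ _]mxE.
    by rewrite !rl.
  have cTu : ctr T \in unitmx by rewrite /ctr map_unitmx unitmx_tr.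
  by move=> /(can_inj (mulmxK cTu))/(can_inj (mulKmx Tu)).
move=> oP oQ; have [pH pp PE] := EP P oP; have [qH qq QE] := EP Q oQ.
have pM (X Y : 'M[algC]_n.+1) :
    (invmx T *m X *m T) *m (invmx T *m Y *m T) = invmx T *m (X *m Y) *m T.
  by rewrite !mulmxA mulmxK.
have comm : p P *m p Q = p Q *m p P.
  apply: commute_projectors => // k.
  pose N := endo_mx f f' P * endo_mx f f' Q * endo_mx f f' P.
  have -> : (p P * p Q * p P) ^+ k = invmx T *m map_mx intr (N ^+ k) *m T.
    elim: k => [|k IH]; first by rewrite !expr0 map_mx1 mulmx1 mulVmx.
    by rewrite !exprS IH -!mulmxE /p !pM !map_mxM.
  rewrite mxtrace_mulC mulmxA mulmxV // mul1mx trace_map_mx.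
  by rewrite intr_int.
have EE : endo_mx f f' P *m endo_mx f f' Q = endo_mx f f' Q *m endo_mx f f' P.
  move: comm; rewrite /p !pM => /(can_inj (mulmxK Tu))/(can_inj (mulKmx _)) e.
  have {}e := e (etrans (unitmx_inv T) Tu); move: e; rewrite /E -!map_mxM => e.
  by apply/matrixP => i j; apply: (@intr_inj algC); move/matrixP/(_ i j): e; rewrite !mxE.
by apply: (can_inj fK); rewrite PE QE QE PE -!mulmxA EE.
Qed.

(** Each [tau i e] is 0 or 1, hence real. *)
Lemma orthoproj_idem e : e * e = e -> orthoproj (fun x => e * x).
Proof.
move=> ee; split=> [x y|x|x y]; rewrite ?mulrDr ?mulrA ?ee //.
apply: eq_bigr => i _; rewrite !rmorphM mulrCA mulrA; congr (_ * _ * _).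
have : tau i e * tau i e == tau i e by rewrite -rmorphM ee.
rewrite -subr_eq0 -{3}[tau i e]mulr1 -mulrBr mulf_eq0 subr_eq0.
by case/orP=> /eqP->; rewrite ?rmorph0 ?rmorph1.
Qed.

(** As u is a root of unity, each [tau i u] has modulus 1: multiplication by u is unitary, with
    adjoint multiplication by v. *)
Lemma orthoproj_conj P u v k : orthoproj P -> u * v = 1 -> u ^+ k.+1 = 1 ->
  orthoproj (fun x => v * P (u * x)).
Proof.
move=> [PD PP Psa] uv uk; split=> [x y|x|x y].
- by rewrite mulrDr PD mulrDr.
- by rewrite [u * (v * _)]mulrA uv mul1r PP.
have tv i : tau i v = (tau i u)^*.
  have uv1 : tau i u * tau i v = 1 by rewrite -rmorphM uv rmorph1.
  have n1 : `|tau i u| = 1.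
    apply/eqP; rewrite -(@pexpr_eq1 _ _ k.+1) // -normrX -rmorphXn uk rmorph1 normr1.
    by [].
  have u0 : tau i u != 0 by rewrite -normr_eq0 n1 oner_eq0.
  by apply: (mulfI u0); rewrite uv1 -normCK n1 expr1n.
transitivity (ip (P (u * x)) (u * y)).
  by apply: eq_bigr => i _; rewrite !rmorphM /= tv; ring.
rewrite Psa; apply: eq_bigr => i _; rewrite !rmorphM /= tv conjCK; ring.
Qed.

(** Equal embeddings would give equal columns of the invertible matrix [T]. *)
Lemma tau_inj i j : tau i =1 tau j -> i = j.
Proof.
move=> e; have /(congr1 (mulmx (invmx T))) : T *m delta_mx i (0 : 'I_1) = T *m delta_mx j 0.
  by rewrite -!colE; apply/colP => k; rewrite !mxE e.
rewrite !mulKmx // => /colP/(_ i); rewrite !mxE !eqxx /=.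
by have [|] := eqVneq i j => // _ /eqP; rewrite oner_eq0.
Qed.

(** For h != k, take a character chi with chi (h - k) != 1. Twisting by chi permutes the embeddings
    and multiplies the form between A h and A k by chi (h - k), so the form vanishes there. *)
Lemma orthoproj_gproj (A : comPzRingType) (G : finZmodType) (s : grs R A G) g :
  separating G -> orthoproj (gproj s g).
Proof.
move=> sepG.
have orth h k x y : h != k -> ip (gproj s h x) (gproj s k y) = 0.
  rewrite -subr_eq0 => /sepG[chi [chi0 chiD chiN chi_hk]].
  have [F FE] : exists F : 'I_n.+1 -> {rmorphism R -> algC},
      forall i h x, F i (gproj s h x) = chi h * tau i (gproj s h x).
    apply: (fin_all_exists (P := fun i (F : {rmorphism R -> algC}) =>
      forall h x, F (gproj s h x) = chi h * tau i (gproj s h x))) => i.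
    have [||F FE] := grs_lift s (tau i \o gi s) (v := fun h => chi h * tau i (gu s h)).
    - by rewrite chi0 gu0 rmorph1 mulr1.
    - by move=> a b; rewrite chiD guD rmorphM /=; ring.
    by exists F => a z; rewrite /gproj FE rmorphM /=; ring.
  have [pi piE] := fin_all_exists (fun i => tau_all (F i)).
  have pi_inj : injective pi.
    move=> i j e; apply: tau_inj => z; rewrite -(gproj_sum s z) !rmorph_sum.
    apply: eq_bigr => a _.
    have chia0 : chi a != 0.
      by apply/eqP => c0; have := chiN a; rewrite c0 mul0r => /eqP; rewrite eq_sym oner_eq0.
    by apply: (mulfI chia0); rewrite -!FE !piE e.
  set I := ip _ _.
  have : I = chi h * (chi k)^* * I.
    rewrite {1}/I /ip (reindex_inj pi_inj) /= mulr_sumr; apply: eq_bigr => i _.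
    by rewrite -!piE !FE rmorphM /=; ring.
  move=> /eqP; rewrite -subr_eq0 -{1}[I]mul1r -mulrBl mulf_eq0 => /orP[|/eqP//].
  rewrite subr_eq0 eq_sym -[h](subrK k) chiD -mulrA chiN mulr1.
  by rewrite (negPf chi_hk).
split=> [x y|x|x y]; first exact: gprojD.
  by rewrite gprojp eqxx.
transitivity (ip (gproj s g x) (gproj s g y)).
  rewrite -{1}(gproj_sum s y) /ip.
  under eq_bigr do rewrite !rmorph_sum mulr_sumr.
  rewrite exchange_big (bigD1 g) //= [X in _ + X]big1 ?addr0 // => h hg.
  by apply: orth; rewrite eq_sym.
rewrite -{2}(gproj_sum s x) /ip.
under [RHS]eq_bigr do rewrite rmorph_sum mulr_suml.
by rewrite exchange_big (bigD1 g) //= [X in _ + X]big1 ?addr0 // => h hg; apply: orth.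
Qed.
End InnerProduct.

(** * Orders and reduced rings *)

(** [is_order] with the rank exposed, for induction on it. *)
Definition order_rank (n : nat) (A : comPzRingType) := exists f : A -> 'rV[int]_n,
  bijective f /\ (forall x y : A, f (x + y) = f x + f y).

(** Additively, C is the image of the idempotent g h of Z^n, and the Smith form of its matrix P
    provides a basis. If no rank is lost, P is invertible and idempotent, hence the identity. *)
Lemma order_retract (A C : comPzRingType) n (g : C -> A) (h : A -> C) :
  {morph g : x y / x + y} -> {morph h : x y / x + y} -> cancel g h ->
  order_rank n A ->
  exists m, [/\ (m <= n)%N, order_rank m C & m = n -> cancel h g].
Proof.
move=> gD hD gK [f [[f' fK f'K] fD]].
have f'D : {morph f' : x y / x + y} by move=> x y; apply: (can_inj fK); rewrite fD !f'K.
pose P := \matrix_i f (g (h (f' (delta_mx 0 i)))).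
have PE v : v *m P = f (g (h (f' v))).
  by apply/esym/(additive_mx (h := fun v => f (g (h (f' v))))) => x y; rewrite f'D hD gD fD.
have PP : P *m P = P.
  by apply/row_matrixP => i; rewrite !rowE mulmxA !PE fK gK.
have [L Lu [U Uu [d _ PD]]] := int_Smith_normal_form P.
pose D := diag_mx (\row_i d`_i) : 'M[int]_n.
have {}PD : P = L *m D *m U.
  by rewrite PD; congr (_ *m _ *m _); apply/matrixP => i j; rewrite !mxE.
have DWD : D *m (U *m L) *m D = D.
  apply: (can_inj (mulKmx Lu)); apply: (can_inj (mulmxK Uu)).
  by rewrite -[RHS]PD -[RHS]PP PD !mulmxA.
have dd (i : 'I_n) : d`_i != 0 -> d`_i * d`_i = 1.
  move=> di; have := congr1 (fun M : 'M_n => M i i) DWD.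
  rewrite mul_diag_mx mul_mx_diag !mxE eqxx mulr1n -mulrA -[RHS]mulr1 => /(mulfI di).
  move=> /(congr1 absz); rewrite abszM => /eqP; rewrite muln_eq1 => /andP[_].
  by case: (d`_i) => [[|[|k]]|[|k]].
(* Since P is idempotent, the nonzero diagonal entries of its Smith form are
   1 or -1, and S selects them. *)
pose J := [set i : 'I_n | d`_i != 0]; pose m := #|J|.
pose S : 'M[int]_(m, n) := \matrix_(k, i) (enum_val k == i)%:R.
have SS : S *m S^T = 1%:M.
  apply/matrixP => k l; rewrite !mxE (bigD1 (enum_val k)) //= !mxE eqxx mul1r.
  rewrite big1 ?addr0 => [|i /negPf ik]; last by rewrite !mxE eq_sym ik mul0r.
  by rewrite (inj_eq enum_val_inj) eq_sym.
have SDD : S *m D *m D = S.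
  apply/matrixP => k i; rewrite !mul_mx_diag !mxE; case: eqP => [<-|]; last by rewrite !mul0r.
  rewrite !mul1r dd //; have := enum_valP k; by rewrite inE.
have DSS : D *m (S^T *m S) = D.
  apply/matrixP => i j; rewrite mul_diag_mx [LHS]mxE [RHS]mxE ![(\row_ _ _) _ _]mxE.
  have [d0|di] := eqVneq d`_i 0; first by rewrite d0 mul0r mul0rn.
  have iJ : i \in J by rewrite inE.
  rewrite [(S^T *m S) _ _]mxE (bigD1 (enum_rank_in iJ i)) //= !mxE enum_rankK_in // eqxx mul1r.
  rewrite big1 ?addr0 => [|k ki]; first by rewrite mulr_natr.
  rewrite !mxE; have [e|] := eqVneq (enum_val k) i; last by rewrite mul0r.
  by case/eqP: ki; apply: enum_val_inj; rewrite enum_rankK_in.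
exists m; split.
- by rewrite -[n in (_ <= n)%N]card_ord max_card.
- exists (fun c => f (g c) *m invmx U *m S^T); split; last first.
    by move=> x y; rewrite gD fD !mulmxDl.
  exists (fun z => h (f' (z *m S *m U))) => [c|z].
    rewrite -[RHS]gK -[in RHS](fK (g c)); congr (h (f' _)).
    have e : f (g c) = f (g c) *m P by rewrite PE fK gK.
    rewrite e PD !mulmxA mulmxK //.
    by rewrite -[_ *m S^T *m S]mulmxA -[_ *m D *m _]mulmxA DSS.
  rewrite -PE PD !mulmxA mulmxK // -{1}SDD.
  have -> : z *m (S *m D *m D) *m U *m L *m D = z *m S *m D *m (D *m (U *m L) *m D).
    by rewrite !mulmxA.
  rewrite DWD -!mulmxA [D *m (D *m _)]mulmxA [S *m (D *m D *m _)]mulmxA.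
  by rewrite [S *m (D *m D)]mulmxA SDD SS mulmx1.
move=> mn a; apply: (can_inj fK); rewrite -{1}(fK a) -PE.
have DD : D *m D = 1%:M.
  have /eqP JT : J == setT by rewrite eqEcard subsetT cardsT card_ord -/m mn leqnn.
  apply/matrixP => i j; rewrite mul_diag_mx !mxE; case: eqP => [_|_]; last by rewrite mulr0.
  by rewrite mulr1n dd //; have := in_setT i; rewrite -JT inE.
have UL : U *m (L *m D) = 1%:M.
  have := congr1 (mulmx D) DWD; by rewrite !mulmxA DD mul1mx.
by rewrite PD (mulmx1C UL) mulmx1.
Qed.

Lemma is_order_retract (A C : comPzRingType) (g : C -> A) (h : A -> C) :
  {morph g : x y / x + y} -> {morph h : x y / x + y} -> cancel g h ->
  is_order A -> is_order C.
Proof.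
move=> gD hD gK [n An]; have [m [_ Cm _]] := order_retract gD hD gK An.
by exists m.
Qed.

Lemma is_order_riso (A B : comPzRingType) : riso A B -> is_order A -> is_order B.
Proof.
move=> /riso_sym/risoP[f [g fK gK]]; apply: (is_order_retract (g := f) (h := g)) => //.
  exact: rmorphD.
by move=> x y; apply: (can_inj fK); rewrite rmorphD !gK.
Qed.

Lemma is_order_gring (A : comPzRingType) (G : finZmodType) :
  is_order A -> is_order (gring A G).
Proof.
move=> [n [f [[f' fK f'K] fD]]]; exists (#|G| * n)%N.
exists (fun x : gring A G => mxvec (\matrix_(i, j) f (x (enum_val i)) 0 j)); split; last first.
  move=> x y; rewrite -linearD; congr mxvec; apply/matrixP => i j.
  by rewrite !mxE ffunE fD mxE.
exists (fun v => [ffun g => f' (row (enum_rank g) (vec_mx v))]) => [x|v].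
  apply/ffunP => g; rewrite ffunE mxvecK -[RHS]fK; congr f'.
  by apply/rowP => j; rewrite !mxE enum_rankK.
rewrite -[RHS]vec_mxK; congr mxvec; apply/matrixP => i j.
by rewrite mxE ffunE f'K mxE enum_valK.
Qed.

(** The coefficient at 0 retracts C[G] onto C. *)
Lemma is_order_coef (A C : comPzRingType) (G : finZmodType) :
  riso A (gring C G) -> is_order A -> is_order C.
Proof.
move=> /is_order_riso AC /AC; have [s] := grs_gring C G.
apply: (is_order_retract (g := gi s) (h := fun r => gc s r 0)).
- exact: rmorphD.
- by move=> x y; rewrite gcD.
- by move=> c; rewrite gc_i eqxx.
Qed.

Lemma is_reduced_inj (A B : comPzRingType) (f : {rmorphism A -> B}) :
  injective f -> is_reduced B -> is_reduced A.
Proof.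
move=> f_inj Br x n xn; apply: f_inj; rewrite rmorph0; apply: (Br _ n).
by rewrite -rmorphXn xn rmorph0.
Qed.

Lemma is_reduced_riso (A B : comPzRingType) : riso A B -> is_reduced B -> is_reduced A.
Proof. by move=> /risoP[f /bij_inj]; apply: is_reduced_inj. Qed.

Lemma is_reduced_coef (A C : comPzRingType) (G : finZmodType) :
  riso A (gring C G) -> is_reduced A -> is_reduced C.
Proof.
move=> /riso_sym/is_reduced_riso AC /AC; have [s] := grs_gring C G.
exact: is_reduced_inj (@gi_inj _ _ _ s).
Qed.

Lemma order_pos (R : comPzRingType) : is_order R -> 1 != 0 :> R ->
  exists n (f : R -> 'rV[int]_n.+1) f', [/\ {morph f : x y / x + y}, cancel f f' & cancel f' f].
Proof.
move=> [[|n] [f [[f' fK f'K] fD]]] nz; last by exists n, f, f'.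
by case/eqP: nz; apply: (can_inj fK); rewrite !thinmx0.
Qed.

(** The coordinates of x are recovered from its values by inverting the matrix of the embeddings. *)
Lemma order_rmorph_inj (R : comPzRingType) (x : R) : is_order R -> is_reduced R ->
  (forall s : {rmorphism R -> algC}, s x = 0) -> x = 0.
Proof.
move=> Ro Rr x0; have [e|nz] := eqVneq (1 : R) 0; first by rewrite -[x]mul1r e mul0r.
have [n [f [f' [fD fK f'K]]]] := order_pos Ro nz.
have [tau [Tu _]] := embeddings fD fK f'K Rr.
apply: (can_inj fK); rewrite (morph_add0 fD); apply/rowP => j; rewrite mxE.
have : map_mx intr (f x) *m \matrix_(k, i) tau i (f' (delta_mx 0 k)) = 0.
  by apply/rowP => i; rewrite (row_tauE fD fK f'K tau x i) x0 mxE.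
move=> /(congr1 (mulmx^~ (invmx (\matrix_(k, i) tau i (f' (delta_mx 0 k)))))).
rewrite mulmxK // mul0mx => /rowP/(_ j); rewrite !mxE => /eqP.
by rewrite intr_eq0 => /eqP.
Qed.

Lemma Zp_exprD (R : pzRingType) (z : R) q (a b : 'Z_q) : (1 < q)%N -> z ^+ q = 1 ->
  z ^+ (a + b)%R = z ^+ a * z ^+ b.
Proof.
move=> q1 zq; rewrite -exprD /= -[LHS](expr_mod _ zq) -[RHS](expr_mod _ zq).
by rewrite modn_dvdm ?Zp_cast.
Qed.

(** A morphism s from A to [algC] and a q-th root of unity define a complex morphism on A['Z_q],
    which kills the nilpotent x. So the polynomial with coefficients s (x a), of degree less than q,
    has q roots and is zero; this holds for all s. *)
Lemma is_reduced_cyclic (A : comPzRingType) q : (1 < q)%N ->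
  is_order A -> is_reduced A -> is_reduced (gring A 'Z_q).
Proof.
move=> q1 Ao Ar x n xn; have [z zp] := C_prim_root_exists (ltnW q1).
apply/ffunP => a; rewrite ffunE; apply: order_rmorph_inj => // s.
(* The bound is the cardinal of ['Z_q] as it is defined, equal to q because q > 1. *)
pose p := \poly_(i < (Zp_trunc q).+2) s (x (inZp i)).
suff p0 : p = 0.
  have := congr1 (fun r : {poly algC} => r`_a) p0; rewrite coef0 coef_poly.
  by rewrite ltn_ord valZpK.
apply/eqP/negPn/negP => p_nz.
have := @max_poly_roots _ p [seq z ^+ i | i <- index_iota 0 q] p_nz.
rewrite size_map size_iota subn0 ltnNge => H; apply: (negP (H _ _)); last first.
- by apply: leq_trans (size_poly _ _) _; rewrite Zp_cast.
- rewrite map_inj_in_uniq ?iota_uniq // => i j; rewrite !mem_index_iota /= => iq jq /eqP.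
  by rewrite (eq_prim_root_expr zp) !modn_small // => /eqP.
apply/allP => _ /mapP[i _ ->]; rewrite /root.
have zD (b c : 'Z_q) : z ^+ i ^+ (b + c)%R = z ^+ i ^+ b * z ^+ i ^+ c.
  by apply: Zp_exprD => //; rewrite -exprM mulnC exprM (prim_expr_order zp) expr1n.
have [|F FE] := gev_rmorph s (u := fun b : 'Z_q => z ^+ i ^+ b) _ zD.
  by rewrite expr0.
have : F x ^+ n = 0 by rewrite -rmorphXn xn rmorph0.
move=> /eqP; rewrite expf_eq0 => /andP[_ /eqP <-]; rewrite FE horner_poly.
by apply/eqP/eq_bigr => b _; rewrite valZpK.
Qed.

(** * Products of cyclic groups of prime power order *)

HB.instance Definition _ (G H : finZmodType) := Finite.on (G * H)%type.

(* 'Z_q is cyclic of order q only for q > 1, which ppow guarantees. *)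
Fixpoint Zl (s : seq nat) : finZmodType :=
  if s is q :: s' then ('Z_q * Zl s')%type else 'I_1.

Definition ppow q := (1 < q)%N && (pdiv q).-nat q.

Lemma ppow_gt1 q : ppow q -> (1 < q)%N. Proof. by case/andP. Qed.

Lemma ppow_coprime q m : ppow q -> coprime q m = ~~ (pdiv q %| m)%N.
Proof.
case/andP=> q1 qp; have pp := pdiv_prime q1.
rewrite -prime_coprime //; apply/idP/idP; first exact/coprime_dvdl/pdiv_dvd.
by move=> cop; have [k ->] := p_natP qp; apply: coprimeXl.
Qed.

Lemma ppow_dvd_pdiv q r : ppow q -> ppow r -> (q %| r)%N -> pdiv r = pdiv q.
Proof.
move=> /andP[q1 _] /andP[r1 rp] qr; apply/esym/eqP.
have := dvdn_trans (pdiv_dvd q) qr.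
have [k rE] := p_natP rp; rewrite {1}rE Euclid_dvdX ?pdiv_prime // => /andP[].
by rewrite dvdn_prime2 ?pdiv_prime.
Qed.

Lemma Zp_unitE q (x : 'Z_q) : ppow q -> (x \is a GRing.unit) = ~~ (pdiv q %| x)%N.
Proof. by move=> qp; rewrite -{1}[x]natr_Zp unitZpE ?ppow_gt1 // ppow_coprime. Qed.

(** ['Z_q] is local: its nonunits are the multiples of one prime. *)
Lemma Zp_unitD q (x y : 'Z_q) : ppow q -> (x + y) \is a GRing.unit ->
  (x \is a GRing.unit) || (y \is a GRing.unit).
Proof.
move=> qp; rewrite !Zp_unitE //; apply: contraR; rewrite negb_or !negbK => /andP[px py].
by rewrite /= /dvdn modn_dvdm ?Zp_cast ?ppow_gt1 ?pdiv_dvd // -/(dvdn _ _) dvdn_add.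
Qed.

Lemma Zp_nat_eq0 q n : (1 < q)%N -> (n%:R == 0 :> 'Z_q) = (q %| n)%N.
Proof. by move=> q1; rewrite -val_eqE /= val_Zp_nat. Qed.

(** A primitive root of unity gives one faithful character, good for every x. *)
Lemma separating_Zp q : (1 < q)%N -> separating 'Z_q.
Proof.
move=> q1 x x0; have [z zp] := C_prim_root_exists (ltnW q1).
exists (fun w : 'Z_q => z ^+ w); split=> //.
- by move=> v w; apply: Zp_exprD => //; apply: prim_expr_order.
- move=> w; rewrite -normCK normrX.
  have -> : `|z| = 1.
    apply/eqP; rewrite -(@pexpr_eq1 _ _ q) ?(ltnW q1) //.
    by rewrite -normrX (prim_expr_order zp) normr1.
  by rewrite !expr1n.
- rewrite /= -[1](expr0 z) (eq_prim_root_expr zp) mod0n.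
  by rewrite -/(dvdn _ _) -Zp_nat_eq0 // natr_Zp.
Qed.

Lemma separating_Zl s : all ppow s -> separating (Zl s).
Proof.
elim: s => [_ g|q s IH /= /andP[/ppow_gt1 q1 /IH{}IH] [x y]].
  by rewrite (ord1 g) eqxx.
have [-> xy|x0 _] := eqVneq x 0.
  have [|chi [chi0 chiD chiN chiy]] := IH y; first by apply: contraNneq xy => ->.
  by exists (fun z => chi z.2); split=> //= z w; rewrite chiD.
have [chi [chi0 chiD chiN chix]] := separating_Zp q1 x0.
by exists (fun z => chi z.1); split=> //= z w; rewrite chiD.
Qed.

(** By locality, [psi] already takes a unit value on the component of x in one cyclic factor. That
    factor must have order q, and [th], with inverse [th'], splits it off. *)
Lemma Zl_extract q t (psi : Zl t -> 'Z_q) x : ppow q -> all ppow t ->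
  {morph psi : x y / x + y} -> x *+ q = 0 -> psi x \is a GRing.unit ->
  q \in t /\ exists (th : 'Z_q -> Zl (rem q t) -> Zl t) th',
  [/\ forall a b c d, th (a + b) (c + d) = th a c + th b d,
      forall x y, th' (th x y) = (x, y), forall h, th (th' h).1 (th' h).2 = h &
      psi (th 1 0) \is a GRing.unit].
Proof.
move=> qp; have q1 := ppow_gt1 qp; elim: t psi x => [|r t IH] psi x /=.
  move=> _ psiD _; rewrite (ord1 x) (morph_add0 psiD) Zp_unitE //.
  by rewrite dvdn0.
case: x => x y /andP[rp tp] psiD xyq; have r1 := ppow_gt1 rp.
have psin z n : psi (z *+ n) = psi z *+ n.
  by elim: n => [|n IHn]; rewrite ?mulr0n ?(morph_add0 psiD) // !mulrS psiD IHn.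
have -> : (x, y) = (x, 0) + (0, y) :> 'Z_r * Zl t by congr pair; rewrite ?addr0 ?add0r.
rewrite psiD => /(Zp_unitD qp)/orP[xu|yu].
  (* The generator of the first factor has a unit value c: r c = 0 gives q | r, and q x = 0 with x
     prime to r gives r | q. *)
  have xE : (x, 0) = (1, 0) *+ x :> 'Z_r * Zl t.
    by rewrite pairMnE /= mul0rn natr_Zp.
  pose c := psi (1, 0); have := xu; rewrite xE psin -mulr_natr unitrM -/c => /andP[cu xu'].
  have qr : (q %| r)%N.
    rewrite -Zp_nat_eq0 //; apply/eqP/(mulrI cu); rewrite mulr0 mulr_natr -psin.
    rewrite pairMnE /= mul0rn -[1 *+ r]/(r%:R) (eqP (_ : r%:R == 0 :> 'Z_r)) ?Zp_nat_eq0 //.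
    by rewrite (morph_add0 psiD).
  have rq : (r %| q)%N.
    rewrite -(@Gauss_dvdr _ x) ?ppow_coprime //.
      rewrite -Zp_nat_eq0 // natrM natr_Zp mulr_natr.
      by have := congr1 fst xyq; rewrite pairMnE /= => ->.
    by rewrite (ppow_dvd_pdiv qp rp qr) -ppow_coprime // -unitZpE.
  have e : r = q by apply/eqP; rewrite eqn_dvd rq qr.
  subst r; rewrite inE eqxx; split=> //.
  by exists (fun a b => (a, b)), id; split=> // [[]].
have [||||qt [th [th' [thD thK th'K thu]]]] := IH (fun y => psi (0, y)) y => //.
- by move=> a b; rewrite -psiD; congr psi; congr pair; rewrite addr0.
- by have := congr1 snd xyq; rewrite pairMnE.
rewrite inE qt orbT; split=> //.
have th00 : th 0 0 = 0 by apply: (addrI (th 0 0)); rewrite -thD !addr0.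
have th'0 : th' 0 = (0, 0) by rewrite -th00 thK.
have th'D u v : th' (u + v) = ((th' u).1 + (th' v).1, (th' u).2 + (th' v).2).
  by rewrite -{1}(th'K u) -{1}(th'K v) -thD thK.
(* If r = q, [rem] deletes the head although the factor found lies in the tail, so the head
   coordinate receives the ['Z_q] component of z. *)
have [e|ne] := eqVneq r q.
  subst r.
  exists (fun a z => ((th' z).1, th a (th' z).2)).
  exists (fun w => ((th' w.2).1, th w.1 (th' w.2).2)); split.
  - by move=> a b c d; rewrite th'D /= thD.
  - by move=> a z /=; rewrite thK /= th'K.
  - by move=> [b u] /=; rewrite thK /= th'K.
  - by rewrite th'0.
exists (fun a z => (z.1, th a z.2)).
exists (fun w => ((th' w.2).1, (w.1, (th' w.2).2))); split=> //.
- by move=> a b c d /=; rewrite thD.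
- by move=> a [b z] /=; rewrite thK.
- by move=> [b u] /=; rewrite th'K.
Qed.

(* The subring P may have a unit e different from that of B. *)
Lemma subrng_exists (B : comPzRingType) (P : {pred B}) (e : B) :
  e \in P -> {in P &, forall x y, x - y \in P} -> {in P &, forall x y, x * y \in P} ->
  {in P, forall x, e * x = x} ->
  exists (C : comPzRingType) (i : C -> B), [/\ {morph i : x y / x + y},
    {morph i : x y / x * y}, i 1 = e, injective i &
    forall b, b \in P <-> exists c, i c = b].
Proof.
move=> Pe PB PM Pe1.
have P0 : 0 \in P by rewrite -(subrr e) PB.
have PN x : x \in P -> - x \in P by move=> Px; rewrite -sub0r PB.
have PD x y : x \in P -> y \in P -> x + y \in P.
  by move=> Px Py; rewrite -[y]opprK PB ?PN.
pose T := {b : B | b \in P}.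
pose zero : T := exist _ 0 P0.
pose opp (x : T) : T := exist _ (- val x) (PN _ (valP x)).
pose add (x y : T) : T := exist _ (val x + val y) (PD _ _ (valP x) (valP y)).
pose one : T := exist _ e Pe.
pose mul (x y : T) : T := exist _ (val x * val y) (PM _ _ (valP x) (valP y)).
have addA : associative add by move=> x y z; apply/val_inj/addrA.
have addC : commutative add by move=> x y; apply/val_inj/addrC.
have add0 : left_id zero add by move=> x; apply/val_inj/add0r.
have addN : left_inverse zero opp add by move=> x; apply/val_inj/addNr.
have mulA : associative mul by move=> x y z; apply/val_inj/mulrA.
have mulC : commutative mul by move=> x y; apply/val_inj/mulrC.
have mul1 : left_id one mul by move=> x; apply/val_inj/Pe1/valP.
have mulDl : left_distributive mul add by move=> x y z; apply/val_inj/mulrDl.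
pose TZ : zmodType := HB.pack T (GRing.isZmodule.Build T addA addC add0 addN).
pose C : comPzRingType :=
  HB.pack T TZ (@GRing.Zmodule_isComPzRing.Build TZ one mul mulA mulC mul1 mulDl).
exists C, (fun x : T => val x); split=> //; first exact: val_inj.
move=> b; split=> [Pb|[c <-]]; last exact: valP.
by exists (exist _ b Pb : T).
Qed.

(** * Two group ring structures on a reduced order *)

Lemma riso_grs (R A : comPzRingType) (G : finZmodType) : grs R A G -> riso R (gring A G).
Proof. by move=> s; apply/riso_sym/grs_riso. Qed.

Lemma gu_torsion (R A : comPzRingType) (G : finZmodType) (s : grs R A G) g :
  exists k, gu s g ^+ k.+1 = 1.
Proof.
exists #|G|.-1; rewrite prednK; last by apply/card_gt0P; exists 0.
rewrite -guMn -(gu0 s); congr (gu s _).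
by have := expg_cardG (in_setT g : g \in [set: G]%G); rewrite cardsT FinRing.zmodXgE.
Qed.

(** Collects the properties of orthogonal projectors used below, with the embeddings hidden behind
    [OP]. *)
Lemma ortho_theory (R : comPzRingType) :
  is_order R -> is_reduced R -> 1 != 0 :> R ->
  exists OP : (R -> R) -> Prop, [/\ forall P Q x, OP P -> OP Q -> P (Q x) = Q (P x),
    forall (A : comPzRingType) G (s : grs R A G) g, separating G -> OP (gproj s g),
    forall P u v k, OP P -> u * v = 1 -> u ^+ k.+1 = 1 -> OP (fun x => v * P (u * x)) &
    forall e, e * e = e -> OP (fun x => e * x)].
Proof.
move=> Ro Rr nz; have [n [f [f' [fD fK f'K]]]] := order_pos Ro nz.
have [tau [Tu tau_all]] := embeddings fD fK f'K Rr.
exists (orthoproj tau); split.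
- by move=> P Q x; apply: (orthoproj_comm fD fK f'K Tu).
- by move=> A G s g; apply: (orthoproj_gproj Tu tau_all).
- exact: orthoproj_conj.
- exact: orthoproj_idem.
Qed.

(** Multiplication by e commutes with the projection onto A; evaluating at 1 puts e in A. *)
Lemma idem_coef (R A : comPzRingType) (G : finZmodType) (s : grs R A G) e :
  is_order R -> is_reduced R -> 1 != 0 :> R -> separating G ->
  e * e = e -> exists a, gi s a = e.
Proof.
move=> Ro Rr nz sepG ee; have [OP [comm proj _ idem]] := ortho_theory Ro Rr nz.
have := comm _ _ 1 (proj _ _ s 0 sepG) (idem _ ee).
have -> : gproj s 0 1 = 1 by rewrite -{1}(rmorph1 (gi s)) gproj0i rmorph1.
by rewrite mulr1 gproj0E => <-; eexists.
Qed.

(** The zero ring satisfies this; [1 != 0] is a separate hypothesis. *)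
Definition connected (R : comPzRingType) := forall e : R, e * e = e -> e = 0 \/ e = 1.

(* With u = gu s g and Q' h the conjugate by u of the projector onto B h, the
   element Q' h 1 = u^-1 (u)_h lies in B, because Q' h commutes with the projector
   onto B; as Q' h is B-linear and a projector, Q' h 1 is idempotent. *)
Lemma homog_units (R A B : comPzRingType) (G H : finZmodType)
    (s : grs R A G) (s' : grs R B H) :
  is_order R -> is_reduced R -> 1 != 0 :> R -> connected R -> separating H ->
  exists (phi : G -> H) (b : G -> B), {morph phi : x y / x + y} /\
    forall g, gu s g = gi s' (b g) * gu s' (phi g).
Proof.
move=> Ro Rr nz conn sepH; have [OP [comm proj conj _]] := ortho_theory Ro Rr nz.
have deg g : exists h, exists b, gu s g = gi s' b * gu s' h.
  set u := gu s g; pose v := gu s (- g); have uv : u * v = 1 := guN s g.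
  have [k uk] := gu_torsion s g.
  pose Q h x := v * gproj s' h (u * x).
  have QOP h : OP (Q h) by apply: conj uk => //; apply: proj.
  have Q0E h : gproj s' 0 (Q h 1) = Q h 1.
    rewrite comm //; last exact: proj.
    by congr (Q h _); rewrite -{1}(rmorph1 (gi s')) gproj0i rmorph1.
  have QQ h : Q h (Q h 1) = Q h 1.
    by rewrite /Q [u * (v * _)]mulrA uv mul1r gprojp eqxx.
  have Qidem h : Q h 1 * Q h 1 = Q h 1.
    have [c cE] : exists c, gi s' c = Q h 1 by rewrite -Q0E gproj0E; eexists.
    have QM : Q h (gi s' c) = gi s' c * Q h 1.
      by rewrite /Q mulr1 [u * _]mulrC gprojM mulrCA.
    by rewrite -{1}cE -QM cE QQ.
  (* If Q h 1 = 1, then u lies in B h. Otherwise every Q h 1 is 0, although their sum is u^-1 u =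
     1. *)
  have [[h eh]|no1] := classic (exists h, Q h 1 = 1).
    exists h, (gc s' u h); move: eh; rewrite /Q mulr1 -/(gproj s' h u) => eh.
    by rewrite -[RHS]mul1r -uv -mulrA eh mulr1.
  case/eqP: nz; rewrite -uv mulrC -(gproj_sum s' u) mulr_sumr big1 // => h _.
  have [] := conn _ (Qidem h); rewrite /Q mulr1 // => e1.
  by case: no1; exists h; rewrite /Q mulr1.
have [phi phiE] := fin_all_exists deg; have [b bE] := fin_all_exists phiE.
(* If [phi] were not additive, a unit would lie in two distinct summands of R and so vanish. *)
exists phi, b; split=> // x y; apply/eqP/negPn/negP => ne; case/eqP: nz.
have := guD s x y; rewrite [in RHS]bE [gu s y]bE mulrACA -rmorphM -guD => e.
have : gproj s' (phi (x + y)) (gu s (x + y)) = gu s (x + y) by rewrite bE gproj_iu.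
rewrite {1}e /gproj gc_iu (negPf ne) rmorph0 mul0r => e0.
by rewrite -(guN s (x + y)) -e0 mul0r.
Qed.

(* C is the intersection of A and B in R. *)
Lemma meet_coefs (R A B : comPzRingType) (G H : finZmodType)
    (s : grs R A G) (s' : grs R B H) (b : G -> B) :
  (forall g, gu s g = gi s' (b g)) ->
  (forall g x, gproj s g (gproj s' 0 x) = gproj s' 0 (gproj s g x)) ->
  exists (C : comPzRingType) (t : grs B C G), gu t =1 b.
Proof.
move=> bE comm; pose P : {pred B} := [pred c : B | gproj s 0 (gi s' c) == gi s' c].
have PP c : reflect (exists a, gi s a = gi s' c) (c \in P).
  rewrite inE; apply: (iffP eqP) => [<-|[a <-]]; last exact: gproj0i.
  by exists (gc s (gi s' c) 0); rewrite gproj0E.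
have [||||C [i [iD iM i1 i_inj iP]]] := @subrng_exists B P 1.
- by apply/PP; exists 1; rewrite !rmorph1.
- by move=> x y /PP[c ce] /PP[d de]; apply/PP; exists (c - d); rewrite !rmorphB ce de.
- by move=> x y /PP[c ce] /PP[d de]; apply/PP; exists (c * d); rewrite !rmorphM ce de.
- by move=> x _; rewrite mul1r.
have [j jE] := rmorph_pack iD iM i1; rewrite -{}jE in i_inj iP; move=> {i iD iM i1}.
(* The A-coefficients of an element of B lie in B: each is [b (- g)] times a projection of it, and
   the projections commute. *)
have coefP x g : exists c, gi s' (j c) = gi s (gc s (gi s' x) g).
  pose r := gi s (gc s (gi s' x) g).
  have rE : r = gi s' (b (- g)) * gproj s g (gi s' x).
    by rewrite /gproj -bE mulrCA guNl mulr1.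
  have r0 : gproj s' 0 r = r.
    by rewrite rE gprojM -comm gproj0i.
  have /iP[c cE] : gc s' r 0 \in P.
    by apply/PP; exists (gc s (gi s' x) g); rewrite -/r -gproj0E r0.
  by exists c; rewrite cE -gproj0E r0.
have b_inj := gi_inj (s := s').
have b0 : b 0 = 1 by apply: b_inj; rewrite -bE gu0 rmorph1.
have bD g h : b (g + h) = b g * b h.
  by apply: b_inj; rewrite rmorphM -!bE guD.
have [coef coefE] : exists coef : B -> G -> C,
    forall x g, gi s' (j (coef x g)) = gi s (gc s (gi s' x) g).
  pose ch x g := ClassicalEpsilon.constructive_indefinite_description _ (coefP x g).
  by exists (fun x g => sval (ch x g)) => x g; case: (ch x g).
exists C; unshelve eexists (@Grs B C G j b coef b0 bD _ _); last by [].
- move=> x; apply: b_inj; rewrite rmorph_sum [LHS](gcE s); apply: eq_bigr => g _.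
  by rewrite rmorphM coefE bE.
- move=> x g; apply/i_inj/b_inj; rewrite coefE rmorph_sum /=.
  have cA c : exists a, gi s a = gi s' (j c) by apply/PP/iP; exists c.
  have [a aE] := fin_all_exists (fun g => cA (x g)).
  rewrite -aE -(gcK s a g); congr (gi s (gc s _ g)).
  by apply: eq_bigr => h _; rewrite rmorphM aE bE.
Qed.

(* The group 'Z_q is local: either c = psi (phi 1) or 1 - c is a unit.  In the first
   case the cyclic factor th 'Z_q of Zl t replaces 'Z_q; in the second the elements
   gu s g * gu s' (- phi g), which lie in B, do. *)
Lemma core_step (R A B : comPzRingType) q t (s : grs R A 'Z_q) (s' : grs R B (Zl t)) :
  is_order R -> is_reduced R -> 1 != 0 :> R -> connected R -> ppow q -> all ppow t ->
  (q \in t /\ riso A (gring B (Zl (rem q t)))) \/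
  exists C, riso B (gring C 'Z_q) /\ riso A (gring C (Zl t)).
Proof.
move=> Ro Rr nz conn qp tp; have q1 := ppow_gt1 qp.
have sepq := separating_Zp q1.
have sept := separating_Zl tp.
have [phi [b [phiD bE]]] := homog_units s s' Ro Rr nz conn sept.
have [psi [a [psiD aE]]] := homog_units s' s Ro Rr nz conn sepq.
pose c := psi (phi 1).
have linZ (k : 'Z_q -> 'Z_q) : {morph k : x y / x + y} -> forall x, k x = x * k 1.
  move=> kD x; have kn m : k m%:R = m%:R * k 1.
    by elim: m => [|m IH]; rewrite ?mul0r ?(morph_add0 kD) // mulrS kD IH mulrDl mul1r.
  by rewrite -[x]natr_Zp kn.
have linb (k : 'Z_q -> 'Z_q) : {morph k : x y / x + y} -> k 1 \is a GRing.unit -> bijective k.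
  move=> kD ku; exists (fun x => x / k 1) => x; first by rewrite (linZ k kD x) mulrK.
  by rewrite linZ // divrK.
have phi0 := morph_add0 phiD; have psi0 := morph_add0 psiD.
have /(Zp_unitD qp)/orP[cu|cu] : c + (1 - c) \is a GRing.unit by rewrite addrC subrK unitr1.
  left; have [|qt [th [th' [thD thK th'K thu]]]] := Zl_extract qp tp psiD _ cu.
    have phin n : phi (1 *+ n) = phi 1 *+ n.
      by elim: n => [|n IHn]; rewrite ?mulr0n // !mulrS phiD IHn.
    by rewrite -phin (eqP (_ : q%:R == 0 :> 'Z_q)) ?Zp_nat_eq0.
  split=> //; have [s2 s2E] := grs_prod s' thD thK th'K.
  have th00 : th 0 0 = 0 by apply: (addrI (th 0 0)); rewrite -thD !addr0.
  have thD0 x y : th (x + y) 0 = th x 0 + th y 0 by rewrite -thD addr0.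
  have kD : {morph (fun x => psi (th x 0)) : x y / x + y} by move=> x y; rewrite thD0 psiD.
  have v0 : gu s' (th 0 0) = 1 by rewrite th00 gu0.
  have vD x y : gu s' (th (x + y) 0) = gu s' (th x 0) * gu s' (th y 0) by rewrite thD0 guD.
  (* The units [gu s' (th x 0)] present R over A, by [aE], and also over B[Zl (rem q t)], by
     [s2]. *)
  have [s1 [_ s1E]] := change_group v0 vD kD (linb _ kD thu) (fun x => aE (th x 0)).
  by apply: (same_group_riso (s := s1) (t := s2)) => x; rewrite s1E s2E.
right; have phiN g : phi (- g) = - phi g.
  by apply: (addrI (phi g)); rewrite -phiD !subrr.
have psiN g : psi (- g) = - psi g.
  by apply: (addrI (psi g)); rewrite -psiD !subrr.
(* [k g] is the degree in ['Z_q] of the corrected unit [gu s g * gu s' (- phi g)]; [k] is bijective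
   because 1 - c is a unit. *)
pose k g := g - psi (phi g).
have kD : {morph k : x y / x + y} by move=> x y; rewrite /k phiD psiD opprD addrACA.
have v0 : gu s 0 * gu s' (- phi 0) = 1 by rewrite phi0 oppr0 !gu0 mulr1.
have vD x y : gu s (x + y) * gu s' (- phi (x + y))
    = gu s x * gu s' (- phi x) * (gu s y * gu s' (- phi y)).
  by rewrite phiD opprD !guD mulrACA.
have vE g : gu s g * gu s' (- phi g) = gi s (a (- phi g)) * gu s (k g).
  by rewrite aE psiN /k guD mulrCA.
have [s1 [_ s1E]] := change_group v0 vD kD (linb _ kD cu) vE.
have [OP [comm proj _ _]] := ortho_theory Ro Rr nz.
have [||C [t' t'E]] := @meet_coefs _ _ _ _ _ s1 s' b.
- by move=> g; rewrite s1E bE -mulrA guN mulr1.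
- by move=> g x; apply: comm; apply: proj.
exists C; split; first exact: riso_grs t'.
(* R = C['Z_q][Zl t] is regrouped as C[Zl t]['Z_q], with the same group elements as [s1] has over
   A. *)
have [s2 s2E] := grs_comp s' t'.
apply: (same_group_riso (s := s1) (t := s2)) => g.
by rewrite s2E t'E s1E bE -mulrA guN mulr1.
Qed.

(** * Splitting along idempotents *)

(* i identifies C with the ring e A, whose unit is e. *)
Definition corner (C A : comPzRingType) (e : A) (i : C -> A) :=
  [/\ {morph i : x y / x + y}, {morph i : x y / x * y}, i 1 = e, injective i &
      forall b, e * b = b -> exists c, i c = b].

Lemma corner_exists (A : comPzRingType) (e : A) : e * e = e ->
  exists (C : comPzRingType) (i : C -> A), corner e i.
Proof.
move=> ee.
have [||||C [i [iD iM i1 i_inj iP]]] := @subrng_exists A [pred x | e * x == x] e.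
- by rewrite inE ee.
- by move=> x y; rewrite !inE mulrBr => /eqP-> /eqP->.
- by move=> x y; rewrite !inE mulrA => /eqP-> _.
- by move=> x; rewrite inE => /eqP.
by exists C, i; split=> // b eb; apply/iP; rewrite inE eb.
Qed.

Lemma corner_id (C A : comPzRingType) (e : A) (i : C -> A) c : corner e i -> e * i c = i c.
Proof. by case=> _ iM <- _ _; rewrite -iM mul1r. Qed.

Lemma corner_proj (C A : comPzRingType) (e : A) (i : C -> A) : corner e i ->
  exists h : A -> C, forall b, i (h b) = e * b.
Proof.
move=> iC; have [_ _ i1 _ iP] := iC.
have ee : e * e = e by rewrite -{2}i1 (corner_id _ iC).
have ex b : exists c, i c = e * b by apply: iP; rewrite mulrA ee.
exists (fun b => sval (ClassicalEpsilon.constructive_indefinite_description _ (ex b))) => b.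
by case: ClassicalEpsilon.constructive_indefinite_description.
Qed.

(** The products a g serve as group elements in a R = (a A)[G]. *)
Lemma corner_grs (R A C D : comPzRingType) (G : finZmodType) (s : grs R A G)
    (a : A) (i : C -> A) (j : D -> R) :
  corner a i -> corner (gi s a) j -> inhabited (grs D C G).
Proof.
move=> iC jC; have [iD iM i1 i_inj _] := iC; have [jD jM j1 j_inj _] := jC.
have [hA hAE] := corner_proj iC; have [hR hRE] := corner_proj jC.
have aa : a * a = a by rewrite -{2}i1 (corner_id _ iC) i1.
have giE c : j (hR (gi s (i c))) = gi s (i c) by rewrite hRE -rmorphM (corner_id _ iC).
have [|||F FE] := @rmorph_pack C D (fun c => hR (gi s (i c))).
- by move=> x y; apply: j_inj; rewrite jD !giE iD rmorphD.
- by move=> x y; apply: j_inj; rewrite jM !giE iM rmorphM.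
- by apply: j_inj; rewrite giE i1 j1.
have jF c : j (F c) = gi s (i c) by rewrite FE giE.
have jFu c g : j (F c * hR (gu s g)) = gi s (i c) * gu s g.
  by rewrite jM jF hRE mulrA -rmorphM mulrC [i c * a]mulrC (corner_id _ iC) mulrC.
have u0 : hR (gu s 0) = 1 by apply: j_inj; rewrite hRE gu0 mulr1.
have uD g h : hR (gu s (g + h)) = hR (gu s g) * hR (gu s h).
  by apply: j_inj; rewrite jM !hRE guD mulrACA -rmorphM aa.
constructor; apply: (@Grs D C G F (fun g => hR (gu s g)) (fun d g => hA (gc s (j d) g)) u0 uD).
- move=> d; apply: j_inj; rewrite (morph_add_sum _ _ _ jD) -[LHS](corner_id _ jC).
  rewrite {1}(gcE s (j d)) mulr_sumr; apply: eq_bigr => g _.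
  by rewrite jFu hAE rmorphM mulrA.
- move=> x g; apply: i_inj; rewrite hAE (morph_add_sum _ _ _ jD).
  by under eq_bigr do rewrite jFu; rewrite gcK (corner_id _ iC).
Qed.

Lemma corner_split (A C D : comPzRingType) (e : A) (i : C -> A) (j : D -> A) :
  e * e = e -> corner e i -> corner (1 - e) j -> riso A (C * D)%type.
Proof.
move=> ee iC jC; have [iD iM i1 i_inj iP] := iC; have [jD jM j1 j_inj _] := jC.
have [h hE] := corner_proj iC; have [k kE] := corner_proj jC.
have e0 : e * (1 - e) = 0 by rewrite mulrBr mulr1 ee subrr.
have ij c d : i c * j d = 0.
  by rewrite -(corner_id c iC) -(corner_id d jC) mulrACA e0 mul0r.
have [|||F FE] := @rmorph_pack (C * D)%type A (fun x => i x.1 + j x.2).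
- by move=> x y; rewrite /= iD jD addrACA.
- move=> x y; rewrite /= iM jM mulrDl !mulrDr ij addr0.
  by rewrite [j _ * i _]mulrC ij add0r.
- by rewrite /= i1 j1 addrC subrK.
apply/riso_sym; apply: (@riso_can _ _ F (fun a => (h a, k a))).
- move=> [c d]; rewrite FE /=; congr pair.
    apply: i_inj; rewrite hE mulrDr (corner_id _ iC) -(corner_id d jC) mulrA e0 mul0r addr0.
    by [].
  apply: j_inj; rewrite kE mulrDr (corner_id _ jC) -(corner_id c iC) mulrA.
  by rewrite [_ * e]mulrC e0 mul0r add0r.
- by move=> a; rewrite FE /= hE kE -mulrDl addrC subrK mul1r.
Qed.

(** Were the rank preserved, [order_retract] would make multiplication by e the identity. *)
Lemma corner_order (A C : comPzRingType) n (e : A) (i : C -> A) :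
  corner e i -> e != 1 -> order_rank n A -> exists m, (m < n)%N /\ order_rank m C.
Proof.
move=> iC e1 An; have [iD iM i1 i_inj _] := iC; have [h hE] := corner_proj iC.
have hD : {morph h : x y / x + y} by move=> x y; apply: i_inj; rewrite iD !hE mulrDr.
have hK : cancel i h by move=> c; apply: i_inj; rewrite hE (corner_id _ iC).
have [m [mn Cm mnE]] := order_retract iD hD hK An; exists m; split=> //.
rewrite ltn_neqAle mn andbT; apply: contra e1 => /eqP/mnE/(_ 1).
by rewrite hE mulr1 => ->.
Qed.

(** As i sends 1 to e, only positive powers are sure to be preserved; hence the exponent [n.+1]. *)
Lemma corner_reduced (A C : comPzRingType) (e : A) (i : C -> A) :
  corner e i -> is_reduced A -> is_reduced C.
Proof.
move=> [iD iM i1 i_inj _] Ar x n xn; have i0 := morph_add0 iD.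
apply: i_inj; rewrite i0; apply: (Ar _ n.+1).
have iX k : i (x ^+ k.+1) = i x ^+ k.+1 by elim: k => // k IH; rewrite exprS iM IH -exprS.
by rewrite -iX exprS xn mulr0 i0.
Qed.

Lemma zero_riso (A B : comPzRingType) : 1 = 0 :> A -> 1 = 0 :> B -> riso A B.
Proof.
move=> A0 B0; have Az (x : A) : x = 0 by rewrite -[x]mul1r A0 mul0r.
have Bz (x : B) : x = 0 by rewrite -[x]mul1r B0 mul0r.
exists (fun=> 0); split=> [|x y|x y|]; rewrite ?B0 ?addr0 ?mulr0 //.
by exists (fun=> 0) => x; rewrite ?(Az x) ?(Bz x).
Qed.

Lemma riso_zero (A B : comPzRingType) : riso A B -> 1 = 0 :> A -> 1 = 0 :> B.
Proof. by move=> /risoP[f _] e; rewrite -(rmorph1 f) e rmorph0. Qed.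

Lemma gring_zero (A : comPzRingType) (G : finZmodType) : 1 = 0 :> A <-> 1 = 0 :> gring A G.
Proof.
have [s] := grs_gring A G; split=> e; first by rewrite -(rmorph1 (gi s)) e rmorph0.
by apply: (gi_inj (s := s)); rewrite rmorph1 e rmorph0.
Qed.

Lemma riso_gring (A B : comPzRingType) (G : finZmodType) :
  riso A B -> riso (gring A G) (gring B G).
Proof.
move=> /riso_sym/risoP[f [g fK gK]]; have [s] := grs_gring A G.
apply: riso_grs; apply: (@Grs _ B G (gi s \o f) (gu s) (fun r x => g (gc s r x)) (gu0 s) (guD s)).
  by move=> r; rewrite {1}(gcE s r); apply: eq_bigr => x _; rewrite /= gK.
by move=> x y; rewrite gcK fK.
Qed.

(** * Isomorphisms of group rings *)

Definition giso (G H : finZmodType) := exists f : G -> H, bijective f /\ {morph f : x y / x + y}.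

Lemma giso_refl G : giso G G. Proof. by exists id; split=> //; exists id. Qed.

Lemma giso_sym G H : giso G H -> giso H G.
Proof.
move=> [f [[g fK gK] fD]]; exists g; split; first by exists f.
by move=> x y; apply: (can_inj fK); rewrite fD !gK.
Qed.

Lemma giso_trans H G K : giso G H -> giso H K -> giso G K.
Proof.
move=> [f [bf fD]] [g [bg gD]]; exists (g \o f); split; first exact: bij_comp.
by move=> x y; rewrite /= fD gD.
Qed.

Lemma giso_inj (G H : finZmodType) (f : G -> H) : injective f -> #|H| = #|G| ->
  {morph f : x y / x + y} -> giso G H.
Proof. by move=> f_inj c fD; exists f; split=> //; apply: inj_card_bij; rewrite ?c. Qed.

Lemma gisoX (G H G' H' : finZmodType) :
  giso G G' -> giso H H' -> giso (G * H)%type (G' * H')%type.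
Proof.
move=> [f [[f' fK f'K] fD]] [k [[k' kK k'K] kD]].
exists (fun x => (f x.1, k x.2)); split; last by move=> x y; rewrite /= fD kD.
by exists (fun x => (f' x.1, k' x.2)) => -[x y] /=; rewrite ?fK ?kK ?f'K ?k'K.
Qed.

Lemma gisoC (G H : finZmodType) : giso (G * H)%type (H * G)%type.
Proof. by exists (fun x => (x.2, x.1)); split=> //; exists (fun x => (x.2, x.1)) => -[]. Qed.

Lemma gisoA (G H K : finZmodType) : giso (G * (H * K))%type ((G * H) * K)%type.
Proof.
exists (fun x => ((x.1, x.2.1), x.2.2)); split=> //.
by exists (fun x => (x.1.1, (x.1.2, x.2))) => [[x [y z]]|[[x y] z]].
Qed.

Lemma gisoCA (G H K : finZmodType) : giso (G * (H * K))%type (H * (G * K))%type.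
Proof.
apply: (giso_trans (gisoA _ _ _)); apply: giso_trans (giso_sym (gisoA _ _ _)).
exact: gisoX (gisoC _ _) (giso_refl _).
Qed.

Lemma giso1 (G : finZmodType) : giso ('I_1 * G)%type G.
Proof.
exists snd; split=> //; exists (fun g => (0, g)) => // -[z g].
by rewrite (ord1 z).
Qed.

Lemma riso_giso (A : comPzRingType) (G H : finZmodType) :
  giso G H -> riso (gring A G) (gring A H).
Proof.
move=> /giso_sym[f [bf fD]]; have [s] := grs_gring A G.
have f0 := morph_add0 fD.
have v0 : gu s (f 0) = 1 by rewrite f0 gu0.
have vD x y : gu s (f (x + y)) = gu s (f x) * gu s (f y) by rewrite fD guD.
have vE x : gu s (f x) = gi s 1 * gu s (f x) by rewrite rmorph1 mul1r.
by have [s' _] := change_group v0 vD fD bf vE; apply: riso_grs s'.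
Qed.

Lemma riso_gringX (A : comPzRingType) (K L : finZmodType) :
  riso (gring A (K * L)%type) (gring (gring A L) K).
Proof.
have [s] := grs_gring A (K * L)%type.
have [|||s' _] := grs_prod s (th := fun a b => (a, b)) (th' := id) => //.
  by case.
exact: riso_grs s'.
Qed.

Lemma riso_gring1 (A : comPzRingType) : riso (gring A 'I_1) A.
Proof.
have [s] := grs_gring A 'I_1; apply/riso_sym.
apply: (@riso_can _ _ (gi s) (fun r => gc s r 0)) => [a|r].
  by rewrite gc_i eqxx.
by rewrite [RHS](gcE s) big_ord1 gu0 mulr1.
Qed.

Lemma riso_prod (A A' B B' : comPzRingType) :
  riso A A' -> riso B B' -> riso (A * B)%type (A' * B')%type.
Proof.
move=> [f [[f' fK f'K] fD fM f1]] [k [[k' kK k'K] kD kM k1]].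
exists (fun x => (f x.1, k x.2)); split.
- by exists (fun x => (f' x.1, k' x.2)) => -[x y] /=; rewrite ?fK ?kK ?f'K ?k'K.
- by move=> x y; rewrite /= fD kD.
- by move=> x y; rewrite /= fM kM.
- by rewrite /= f1 k1.
Qed.

Lemma fst_sum (A B : zmodType) I (r : seq I) (P : pred I) (F : I -> A * B) :
  (\sum_(i <- r | P i) F i).1 = \sum_(i <- r | P i) (F i).1.
Proof. exact: (big_morph (fun x : A * B => x.1)). Qed.

Lemma snd_sum (A B : zmodType) I (r : seq I) (P : pred I) (F : I -> A * B) :
  (\sum_(i <- r | P i) F i).2 = \sum_(i <- r | P i) (F i).2.
Proof. exact: (big_morph (fun x : A * B => x.2)). Qed.

Lemma riso_gring_prod (A B : comPzRingType) (G : finZmodType) :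
  riso (gring (A * B)%type G) (gring A G * gring B G)%type.
Proof.
exists (fun x : gring (A * B)%type G =>
  ([ffun g => (x g).1] : gring A G, [ffun g => (x g).2] : gring B G)); split.
- exists (fun y : gring A G * gring B G => [ffun g => (y.1 g, y.2 g)] : gring (A * B)%type G) => [x|[y z]].
    by apply/ffunP => g; rewrite !ffunE; case: (x g).
  by congr pair; apply/ffunP => g; rewrite !ffunE.
- by move=> x y; congr pair; apply/ffunP => g; rewrite !ffunE.
- move=> x y; congr pair; apply/ffunP => g; rewrite !ffunE ?fst_sum ?snd_sum;
    by apply: eq_bigr => h _; rewrite !ffunE.
- by congr pair; apply/ffunP => g; rewrite !ffunE; case: eqP.
Qed.

(** * Cancelling one cyclic factor *)

Lemma Zl_rem q t : q \in t -> giso (Zl t) ('Z_q * Zl (rem q t))%type.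
Proof.
elim: t => // r t IH; rewrite inE eq_sym /=; case: eqVneq => [->|_] /= qt.
  exact: giso_refl.
apply: giso_trans (gisoCA _ _ _); exact: gisoX (giso_refl _) (IH qt).
Qed.

(** Induction on the rank of A. A nontrivial idempotent of R lies in A and in B and cuts both into
    corners; the connected case is [core_step]. Since the alternative depends on q and t only, both
    corners reach the same conclusion and their products can be formed. *)
Lemma cyclic_step n (A B : comPzRingType) q t : order_rank n A -> is_reduced A ->
  ppow q -> all ppow t -> riso (gring A 'Z_q) (gring B (Zl t)) ->
  if q \in t then riso A (gring B (Zl (rem q t)))
  else exists C, riso B (gring C 'Z_q) /\ riso A (gring C (Zl t)).
Proof.
move=> An Ar qp tp; have [m] := ubnP n; elim: m => // m IH in n A B An Ar *.
rewrite ltnS => nm AB.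
have [A0|nzA] := eqVneq (1 : A) 0.
  have B0 : 1 = 0 :> B.
    apply: (gring_zero B (Zl t)).2; apply: (riso_zero AB).
    exact: (gring_zero A 'Z_q).1.
  case: ifP => _; first by apply: (zero_riso A0); apply: (gring_zero _ _).1.
  by exists B; split; apply: zero_riso => //; apply: (gring_zero _ _).1.
have Ao : is_order A by exists n.
have Ro := is_order_gring 'Z_q Ao; have Rr := is_reduced_cyclic (ppow_gt1 qp) Ao Ar.
have nz : 1 != 0 :> gring A 'Z_q by apply: contra nzA => /eqP/(gring_zero A 'Z_q).2/eqP.
have [s] := grs_gring A 'Z_q; have [s'] := (grs_riso _ _ _).1 (riso_sym AB).
have [[e [ee [e0 e1]]]|conn] := classic (exists e : gring A 'Z_q, e * e = e /\ e <> 0 /\ e <> 1).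
  have sepq := separating_Zp (ppow_gt1 qp).
  have sept := separating_Zl tp.
  have [a aE] := idem_coef s Ro Rr nz sepq ee.
  have [b bE] := idem_coef s' Ro Rr nz sept ee.
  (* The conclusion for one corner, to be used for e and for 1 - e. *)
  have half (e' : gring A 'Z_q) a' b' : e' * e' = e' -> e' <> 1 ->
      gi s a' = e' -> gi s' b' = e' ->
      exists (C D : comPzRingType) (i : C -> A) (j : D -> B), [/\ corner a' i, corner b' j &
      if q \in t then riso C (gring D (Zl (rem q t)))
      else exists E, riso D (gring E 'Z_q) /\ riso C (gring E (Zl t))].
    move=> e'e' e'1 a'E b'E.
    have a'a' : a' * a' = a' by apply: (gi_inj (s := s)); rewrite rmorphM a'E.
    have b'b' : b' * b' = b' by apply: (gi_inj (s := s')); rewrite rmorphM b'E.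
    have a'1 : a' != 1 by apply/eqP => a1; case: e'1; rewrite -a'E a1 rmorph1.
    have [C [i iC]] := corner_exists a'a'; have [D [j jC]] := corner_exists b'b'.
    exists C, D, i, j; split=> //.
    have [k [kn Ck]] := corner_order iC a'1 An.
    apply: (IH k); [exact: Ck|exact: corner_reduced iC Ar|exact: leq_trans kn nm|].
    have [E [l lC]] := corner_exists e'e'.
    have [s1] : inhabited (grs E C 'Z_q) by apply: (corner_grs (s := s) (j := l) iC); rewrite a'E.
    have [s2] : inhabited (grs E D (Zl t)) by apply: (corner_grs (s := s') (j := l) jC); rewrite b'E.
    exact: riso_trans (riso_sym (riso_grs s1)) (riso_grs s2).
  have [C [D [i [j [iC jC CD]]]]] := half e a b ee e1 aE bE.
  have [||||C' [D' [i' [j' [iC' jC' CD']]]]] := half (1 - e) (1 - a) (1 - b).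
  - by rewrite mulrBl mul1r mulrBr mulr1 ee subrr subr0.
  - move=> e'1; apply: e0; apply/eqP; rewrite -oppr_eq0 -(addrK 1 (- e)).
    by rewrite [- e + 1]addrC e'1 subrr.
  - by rewrite rmorphB rmorph1 aE.
  - by rewrite rmorphB rmorph1 bE.
  have aa : a * a = a by apply: (gi_inj (s := s)); rewrite rmorphM aE.
  have bb : b * b = b by apply: (gi_inj (s := s')); rewrite rmorphM bE.
  have A2 := corner_split aa iC iC'; have B2 := corner_split bb jC jC'.
  case: ifP CD CD' => qt.
    move=> CD CD'; apply: (riso_trans A2); apply: riso_trans (riso_gring _ (riso_sym B2)).
    by apply: riso_trans (riso_prod CD CD') (riso_sym (riso_gring_prod _ _ _)).
  move=> [E [DE CE]] [E' [DE' CE']]; exists (E * E')%type; split.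
    apply: (riso_trans B2).
    exact: riso_trans (riso_prod DE DE') (riso_sym (riso_gring_prod _ _ _)).
  apply: (riso_trans A2).
  exact: riso_trans (riso_prod CE CE') (riso_sym (riso_gring_prod _ _ _)).
have {}conn : connected (gring A 'Z_q).
  move=> e ee; have [->|e0] := eqVneq e 0; first by left.
  right; apply: NNPP => e1; apply: conn; exists e; split=> //; split=> //.
  exact/eqP.
have [[qt AB']|[C [BC AC]]] := core_step s s' Ro Rr nz conn qp tp; first by rewrite qt.
case: ifP => qt; last by exists C.
(* With q in t, A = C[Zl t] = C['Z_q][Zl (rem q t)] = B[Zl (rem q t)]. *)
apply: (riso_trans AC); apply: (riso_trans (riso_giso _ (Zl_rem qt))).
apply: riso_trans (riso_gring _ (riso_sym BC)).
apply: riso_trans (riso_giso _ (gisoC _ _)) (riso_gringX _ _ _).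
Qed.

(** * The structure of finite abelian groups *)

Definition decomposable (G : finZmodType) := exists t, all ppow t /\ giso G (Zl t).

Lemma decomposable_giso (G H : finZmodType) : giso G H -> decomposable H -> decomposable G.
Proof. by move=> GH [t [tp Ht]]; exists t; split=> //; apply: giso_trans Ht. Qed.

Lemma Zl_cat s t : giso (Zl (s ++ t)) (Zl s * Zl t)%type.
Proof.
elim: s => [|q s IH] /=; first exact/giso_sym/giso1.
by apply: giso_trans (gisoA _ _ _); apply: gisoX (giso_refl _) IH.
Qed.

Lemma decomposableX (G H : finZmodType) :
  decomposable G -> decomposable H -> decomposable (G * H)%type.
Proof.
move=> [s [sp Gs]] [t [tp Ht]]; exists (s ++ t); split; first by rewrite all_cat sp.
by apply: giso_trans (giso_sym (Zl_cat _ _)); apply: gisoX.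
Qed.

Lemma Zp_chinese k m n : (1 < m)%N -> (1 < n)%N -> coprime m n -> k = (m * n)%N ->
  giso ('Z_k) ('Z_m * 'Z_n)%type.
Proof.
move=> m1 n1 co kE; have k1 : (1 < k)%N by rewrite kE (ltn_trans m1) // ltn_Pmulr // ltnW.
pose f (x : 'Z_k) : 'Z_m * 'Z_n := (x%:R, x%:R).
have fD : {morph f : x y / x + y}.
  have e d (x y : 'Z_k) : (1 < d)%N -> (d %| k)%N ->
      (x + y)%R%:R = x%:R + y%:R :> 'Z_d.
    move=> d1 dk; rewrite -natrD; apply: val_inj; rewrite /= !val_Zp_nat //.
    by rewrite modn_dvdm ?Zp_cast.
  have [mk nk] : (m %| k)%N /\ (n %| k)%N by rewrite kE dvdn_mulr ?dvdn_mull.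
  by move=> x y; congr pair; apply: e.
apply: (giso_inj (f := f)) => //; last by rewrite card_prod !card_ord !Zp_cast.
have f0 x : f x = 0 -> x = 0.
  move=> [/eqP + /eqP]; rewrite !Zp_nat_eq0 // => mx nx.
  apply/eqP; rewrite -[x]natr_Zp Zp_nat_eq0 //; move: (nat_of_ord x) mx nx => j mj nj.
  by rewrite kE Gauss_dvd // mj.
move=> x y e; apply/eqP; rewrite -subr_eq0; apply/eqP/f0.
have fN z : f (- z) = - f z.
  by apply: (addrI (f z)); rewrite -fD !subrr (morph_add0 fD).
by rewrite fD fN e subrr.
Qed.

Lemma decomposable_Zp m : (1 < m)%N -> decomposable 'Z_m.
Proof.
have [k] := ubnP m; elim: k m => // k IH m; rewrite ltnS => mk m1.
have m0 : (0 < m)%N := ltnW m1.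
pose p := pdiv m; have pp : prime p := pdiv_prime m1.
have pq : (1 < m`_p)%N by rewrite p_part_gt1 pi_pdiv.
have ppq : ppow (m`_p)%N.
  have [j e] := p_natP (part_pnat p m); rewrite /ppow pq.
  have pdivE : pdiv (m`_p)%N = p.
    by move: pq; rewrite e; case: (j) => // i _; apply: pdiv_pfactor.
  by rewrite pdivE part_pnat.
(* A prime power m is treated apart, because ['Z_1] has two elements. *)
have [le1|gt1] := leqP (m`_p^') 1.
  have e : m = (m`_p)%N.
    rewrite -{1}(partnC p m0) (_ : (m`_p^')%N = 1%N) ?muln1 //.
    by apply/eqP; rewrite eqn_leq le1 part_gt0.
  exists [:: m]; rewrite /= {1}e ppq; split=> //.
  exact/giso_sym/(giso_trans (gisoC _ _))/giso1.
apply: (@decomposable_giso _ ('Z_(m`_p)%N * 'Z_(m`_p^')%N)%type).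
  by apply: Zp_chinese => //; [apply: coprime_partC|rewrite partnC].
apply: decomposableX.
  exists [:: (m`_p)%N]; rewrite /= ppq; split=> //.
  exact/giso_sym/(giso_trans (gisoC _ _))/giso1.
apply: IH => //; apply: leq_trans mk; rewrite -{2}(partnC p m0).
by rewrite ltn_Pmull // part_gt0.
Qed.

(** Turns an internal direct product of cycles into an external one; injectivity holds because each
    cycle meets the product of the later ones trivially. *)
Lemma decomposable_dprod (G : finZmodType) (b : seq G) (K : {group G}) :
  (\big[dprod/1]_(x <- b) <[x]> = K)%g -> all (fun x : G => 1 < #[x]%g)%N b ->
  exists (Z : finZmodType) (th : Z -> G), [/\ decomposable Z, injective th,
    {morph th : x y / x + y}, forall z, th z \in K & #|Z| = #|K|].
Proof.
elim: b K => [|x b IH] K; rewrite ?big_nil ?big_cons.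
  move=> K1 _; exists 'I_1, (fun=> 0); split.
  - by exists [::]; split=> //; apply: giso_refl.
  - by move=> y z _; rewrite (ord1 y) (ord1 z).
  - by move=> y z; rewrite addr0.
  - by move=> z; apply: (group1 K).
  - by rewrite card_ord -K1 cards1.
move=> dK /= /andP[x1 bp]; have [[_ K' _ eK'] dKK _ triv] := dprodP dK.
have [Z [th [Zd th_inj thD thK cZ]]] := IH K' eK' bp.
pose m := #[x]%g; exists ('Z_m * Z)%type, (fun w : 'Z_m * Z => x *+ w.1 + th w.2).
have xo : x *+ #[x]%g = 0 by rewrite -FinRing.zmodXgE expg_order.
have xmod k : x *+ (k %% #[x]%g) = x *+ k.
  by rewrite {2}(divn_eq k #[x]%g) mulrnDr mulnC mulrnA xo mul0rn add0r.
have xD (a c : 'Z_m) : x *+ (a + c)%R = x *+ a + x *+ c.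
  rewrite -mulrnDr -[RHS]xmod -[LHS]xmod; congr (x *+ _).
  by rewrite /= modn_dvdm ?Zp_cast.
have fD : {morph (fun w : 'Z_m * Z => x *+ w.1 + th w.2) : u v / u + v}.
  by move=> u v; rewrite /= xD thD addrACA.
have xc (a : nat) : x *+ a \in <[x]>%g by rewrite -FinRing.zmodXgE mem_cycle.
split=> //.
- by apply: decomposableX Zd; apply: decomposable_Zp.
- have f0 (w : 'Z_m * Z) : x *+ w.1 + th w.2 = 0 -> w = 0.
    move=> e0; have xth : x *+ w.1 = - th w.2 by apply/eqP; rewrite -subr_eq0 opprK e0.
    have : x *+ w.1 \in (<[x]> :&: K')%g.
      by rewrite inE xc xth; apply: (groupVr (thK w.2)).
    rewrite -eK' triv => /set1P x0.
    have th0 : th w.2 = 0 by apply: oppr_inj; rewrite -xth x0 oppr0.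
    case: w {e0 xth} x0 th0 => a z /= x0 th0; congr pair.
      apply/eqP; rewrite -[a]natr_Zp Zp_nat_eq0 // order_dvdn FinRing.zmodXgE.
      exact/eqP.
    by apply: th_inj; rewrite th0 (morph_add0 thD).
  move=> u v e; apply/eqP; rewrite -subr_eq0; apply/eqP/f0.
  have := fD (u - v) v; rewrite subrK /= e => /esym.
  by rewrite -[RHS]add0r => /addIr.
- move=> w; rewrite -dKK; apply/mulsgP; exists (x *+ w.1) (th w.2) => //.
  by rewrite eK'.
- by rewrite card_prod card_ord Zp_cast // cZ -(dprod_card dK) eK'.
Qed.

Lemma finZmod_decomposable (G : finZmodType) : decomposable G.
Proof.
have [b dG oG] := abelian_structure (FinRing.zmod_abelian [set: G]%G).
have [|Z [th [Zd th_inj thD _ cZ]]] := decomposable_dprod dG.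
  have := abelian_type_gt1 [set: G]; rewrite -oG => /allP H.
  by apply/allP => x xb; apply: H; apply: map_f.
apply: decomposable_giso Zd; apply: giso_sym; apply: (giso_inj th_inj) => //.
by rewrite cZ cardsT.
Qed.

(** * Induction on the cyclic factors and proof of the equivalence *)

Lemma gring_Zl_order (A : comPzRingType) s : is_order A -> is_reduced A -> all ppow s ->
  is_order (gring A (Zl s)) /\ is_reduced (gring A (Zl s)).
Proof.
move=> Ao Ar; elim: s => [_|q s IH /= /andP[qp /IH[so sr]]].
  split; first exact: is_order_gring.
  exact: is_reduced_riso (riso_gring1 A) Ar.
split; first exact: is_order_gring.
apply: is_reduced_riso (riso_gringX _ _ _) _.
exact: is_reduced_cyclic (ppow_gt1 qp) so sr.
Qed.

(** Induction on s, with [cyclic_step] applied to A[Zl s] as coefficient ring. If q is in t, that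
    factor is removed from both groups; otherwise B = C['Z_q] with A[Zl s] = C[Zl t], and ['Z_q] is
    added to J. *)
Lemma group_ring_iso_Zl s t (A B : comPzRingType) :
  is_order A -> is_reduced A -> is_order B -> is_reduced B ->
  all ppow s -> all ppow t -> riso (gring A (Zl s)) (gring B (Zl t)) ->
  exists (C : comPzRingType) (I J : finZmodType),
    [/\ is_order C, riso A (gring C I), riso B (gring C J) &
        giso (I * Zl s)%type (J * Zl t)%type].
Proof.
elim: s t A B => [|q s IH] t A B Ao Ar Bo Br /=.
  move=> _ tp AB; exists B, (Zl t), 'I_1; split=> //.
  - exact: riso_trans (riso_sym (riso_gring1 _)) AB.
  - exact/riso_sym/riso_gring1.
  - exact: gisoC.
move=> /andP[qp sp] tp AB;
have [A1o A1r] := gring_Zl_order Ao Ar sp.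
have [n A1n] := A1o.
have := cyclic_step A1n A1r qp tp (riso_trans (riso_sym (riso_gringX _ _ _)) AB).
case: ifP => qt; last first.
  move=> [C [BC AC]].
  have Co := is_order_coef BC Bo; have Cr := is_reduced_coef BC Br.
  have [D [I [J [Do AI CJ IJ]]]] := IH t A C Ao Ar Co Cr sp tp AC.
  exists D, I, ('Z_q * J)%type; split=> //.
    apply: (riso_trans BC); apply: (riso_trans (riso_gring _ CJ)).
    exact: riso_sym (riso_gringX _ _ _).
  apply: (giso_trans (gisoCA _ _ _)); apply: giso_trans (gisoA _ _ _).
  exact: gisoX (giso_refl _) IJ.
have tp' : all ppow (rem q t) by apply/allP => x /mem_rem/(allP tp).
move=> AB'; have [C [I [J [Co AI BJ IJ]]]] := IH _ _ _ Ao Ar Bo Br sp tp' AB'.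
exists C, I, J; split=> //.
apply: (giso_trans (gisoCA _ _ _)).
apply: (giso_trans (gisoX (giso_refl _) IJ)); apply: (giso_trans (gisoCA _ _ _)).
exact: gisoX (giso_refl _) (giso_sym (Zl_rem qt)).
Qed.

Theorem theorem1p1 (A B : comPzRingType) (G H : finZmodType) :
  is_order A -> is_reduced A -> is_order B -> is_reduced B ->
  (grp_rings_iso A B G H <->
   exists (C : comPzRingType) (I J : finZmodType),
     [/\ is_order C, ring_iso_grp_ring A C I, ring_iso_grp_ring B C J &
         prod_grp_iso I G J H]).
Proof.
move=> Ao Ar Bo Br; split=> [AB|[C [I [J [_ AI BJ IJ]]]]].
  have [s [sp Gs]] := finZmod_decomposable G.
  have [t [tp Ht]] := finZmod_decomposable H.
  have ABst : riso (gring A (Zl s)) (gring B (Zl t)).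
    apply: (riso_trans (riso_giso _ (giso_sym Gs))); apply: riso_trans (riso_giso _ Ht).
    exact: AB.
  have [C [I [J [Co AI BJ IJ]]]] := group_ring_iso_Zl Ao Ar Bo Br sp tp ABst.
  exists C, I, J; split=> //.
  exact: giso_trans (gisoX (giso_refl I) Gs) (giso_trans IJ (gisoX (giso_refl J) (giso_sym Ht))).
(* For the converse, A[G] and B[H] are the group rings over C of I x G and J x H. *)
suff : riso (gring A G) (gring B H) by [].
have step (A' : comPzRingType) (I' G' : finZmodType) :
    riso A' (gring C I') -> riso (gring A' G') (gring C (I' * G')%type).
  move=> AI'; apply: (riso_trans (riso_gring _ AI')).
  by apply: riso_trans (riso_giso _ (gisoC _ _)); apply/riso_sym/riso_gringX.
apply: (riso_trans (step _ _ _ AI)); apply: riso_trans (riso_sym (step _ _ _ BJ)).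
exact: riso_giso IJ.
Qed.
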